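(* Let $P$ and $Q$ be simple convex $n$-polytopes, each with $m$ facets, and let $f\colon\mathcal{Z}_P\to\mathcal{Z}_Q$ be a $\mathbb{T}^m$-equivariant diffeomorphism of their moment-angle manifolds. Then the following hold. (1) $f(R_1e^{i\varphi_1},\dots,R_me^{i\varphi_m})$ has the form $$\bigl(e^{i\varphi_1}g_1(R_1,\dots,R_m)e^{i\psi_1(R_1,\dots,R_m)},\dots,e^{i\varphi_m}g_m(R_1,\dots,R_m)e^{i\psi_m(R_1,\dots,R_m)}\bigr),$$ where $g_k=0$ if $R_k=0$, and $g_k(R_1,\dots,R_m)\geqslant 0$ and $\psi_k(R_1,\dots,R_m)$ are continuous functions on $P$, where $P$ is considered as the image of the section $s_P\colon P\to\mathbb{R}\mathcal{Z}_P\subset\mathcal{Z}_P\subset\mathbb{C}^m$, $$s_P(\boldsymbol{x})=\bigl(\sqrt{\boldsymbol{a}_1\boldsymbol{x}+b_1},\dots,\sqrt{\boldsymbol{a}_m\boldsymbol{x}+b_m}\bigr).$$ (2) The mapping $$g(R_1,\dots,R_m)=(g_1(R_1,\dots,R_m),\dots,g_m(R_1,\dots,R_m))$$ is a diffeomorphism of smoothness at least $C^1$ between $P$ and $Q$ with quadratic smooth structures ($P$ and $Q$ being identified with $s_P(P)$ and $s_Q(Q)$). Moreover, it maps facets to facets, and in the local coordinates $R_{i_1},\dots,R_{i_n}$ at each vertex $v=F_{i_1}\cap\dots\cap F_{i_n}$ of $P$, for the functions $\widetilde{g}_{i_s}(R_{i_1},\dots,R_{i_n})=g_{i_s}(R_1,\dots,R_m)$,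 we have $\frac{\partial\widetilde{g}_{i_s}}{\partial R_{i_t}}=0$ whenever $t\ne s$ and $R_{i_t}=0$. (3) The mapping $$\widehat{f}(u_1,\dots,u_m)=\bigl(\mathrm{sign}(u_1)g_1(|u_1|,\dots,|u_m|),\dots,\mathrm{sign}(u_m)g_m(|u_1|,\dots,|u_m|)\bigr)$$ is a $\mathbb{Z}_2^m$-equivariant diffeomorphism $\mathbb{R}\mathcal{Z}_P\to\mathbb{R}\mathcal{Z}_Q$ of smoothness at least $C^1$.
   Context: A simple $n$-polytope with $m$ facets is given as a bounded intersection of half-spaces $P=\{\boldsymbol{x}\in\mathbb{R}^n\colon \boldsymbol{a}_i\boldsymbol{x}+b_i\geqslant 0,\ i=1,\dots,m\}$, where the facets are exactly $F_i=\{\boldsymbol{x}\in P\colon \boldsymbol{a}_i\boldsymbol{x}+b_i=0\}$, $i=1,\dots,m$ (no inequality is redundant), and each vertex lies in exactly $n$ facets. Let $j_P(\boldsymbol{x})=(\boldsymbol{a}_1\boldsymbol{x}+b_1,\dots,\boldsymbol{a}_m\boldsymbol{x}+b_m)\in\mathbb{R}^m$. The moment-angle manifold is $\mathcal{Z}_P=\{(z_1,\dots,z_m)\in\mathbb{C}^m\colon(|z_1|^2,\dots,|z_m|^2)\in j_P(P)\}$, and the real moment-angle manifold is $\mathbb{R}\mathcal{Z}_P=\mathcal{Z}_P\cap\mathbb{R}^m$. Both are nondegenerate intersections of real quadrics (in $\mathbb{C}^m$, respectively $\mathbb{R}^m$): if $C=(c_{i,k})$ is an $(m-n)\times m$ matrix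 of rank $m-n$ with $CA=0$, where $A$ has rows $\boldsymbol{a}_i$, the equations are $\sum_k c_{i,k}|z_k|^2=\sum_k c_{i,k}b_k$, $i=1,\dots,m-n$. So both are smooth submanifolds and carry the resulting smooth structures. The torus $\mathbb{T}^m=(S^1)^m$ acts on $\mathcal{Z}_P$ by coordinatewise multiplication, and $\mathbb{Z}_2^m=\{\pm1\}^m$ acts on $\mathbb{R}\mathcal{Z}_P$ by changing signs of coordinates. Points of $\mathcal{Z}_P$ are written $z_k=R_ke^{i\varphi_k}$ with $R_k=|z_k|\geqslant0$; then $(R_1,\dots,R_m)\in s_P(P)$. The same definitions apply to $Q$. A manifold with corners of dimension $n$ has an atlas with charts onto open subsets of $\mathbb{R}^n_{\geqslant}=\{\boldsymbol{y}\in\mathbb{R}^n\colon y_i\geqslant0\ \forall i\}$ and smooth transition maps, where a map between open subsets of $\mathbb{R}^n_{\geqslant}$ is smooth if it is a restriction of a smooth map of open subsets of $\mathbb{R}^n$. (Derivatives at boundary points with respect to a coordinate that vanishes there are one-sided derivatives.) Quadratic smooth structure on $P$: for each vertex $v=F_{i_1}\cap\dots\cap F_{i_n}$, with $\omega_v=\{i_1,\dots,i_n\}$, the chart domain is $P_v=P\setminus\bigcup_{j\notin\omega_v}F_j$ with coordinates $R_j=\sqrt{\boldsymbol{a}_j\boldsymbol{x}+b_j}$, $j\in\omega_v$. On $P_v$ the remaining $R_j$, $j\notin\omega_v$, are positive smooth functions of $R_{i_1},\dots,R_{i_n}$. The quadratic smooth structure on $Q$ is defined in the same way. *)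

(* Defs.v *)
From HB Require Import structures.
From mathcomp Require Export all_boot all_order all_algebra.
From mathcomp Require Export complex.
From mathcomp Require Export all_classical all_reals all_analysis.

Set Implicit Arguments.
Unset Strict Implicit.
Unset Printing Implicit Defensive.

Export Order.TTheory GRing.Theory Num.Theory.
Export numFieldNormedType.Exports.

#[global] Open Scope classical_set_scope.
#[global] Open Scope ring_scope.

Section Smoothness.
Context {R : realType}.

(* Meant for finite-dimensional normed modules: continuity in [x] of ['d F x v]
   for all [v] is then continuity of the differential for the operator norm. *)
Fixpoint Ck_on {V W : normedModType R} (k : nat) (U : set V) (F : V -> W) :
    Prop :=
  if k is k'.+1 then
    (forall x, U x -> differentiable F x) /\
    (forall v, Ck_on k' U (fun x => 'd F x v))
  else forall x, U x -> {for x, continuous F}.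

(* [Some k] is C^k, [None] is C^oo *)
Definition Cr_on {V W : normedModType R} (r : option nat) (U : set V)
    (F : V -> W) : Prop :=
  if r is Some k then Ck_on k U F else forall k, Ck_on k U F.

(* C^r maps between subsets of vector spaces: locally, restrictions of C^r maps
   of the ambient spaces. On embedded submanifolds this is C^r-smoothness for
   the induced smooth structure. *)
Definition Cr_map {V W : normedModType R} (r : option nat) (X : set V)
    (f : V -> W) : Prop :=
  forall x, X x -> exists (U : set V) (F : V -> W),
    [/\ open U, U x, Cr_on r U F & forall y, X y -> U y -> F y = f y].

Definition Cr_diffeo {V W : normedModType R} (r : option nat)
    (X : set V) (Y : set W) (f : V -> W) : Prop :=
  exists h : W -> V,
    [/\ (forall x, X x -> Y (f x) /\ h (f x) = x),
        (forall y, Y y -> X (h y) /\ f (h y) = y),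
        Cr_map r X f & Cr_map r Y h].

(* Smoothness on C^m is the real one, on R^m x R^m. *)
Definition realify m (z : 'rV[R[i]]_m) : 'rV[R]_m * 'rV[R]_m :=
  (map_mx (@complex.Re R) z, map_mx (@complex.Im R) z).

Definition complexify m (p : 'rV[R]_m * 'rV[R]_m) : 'rV[R[i]]_m :=
  \row_k Complex (p.1 0 k) (p.2 0 k).

Definition complex_Cr_diffeo m (r : option nat) (X Y : set 'rV[R[i]]_m)
    (f : 'rV[R[i]]_m -> 'rV[R[i]]_m) : Prop :=
  Cr_diffeo r (@realify m @` X) (@realify m @` Y)
    (@realify m \o f \o @complexify m).

Definition orthant n : set 'rV[R]_n := [set y | forall i, 0 <= y 0 i].

Definition corner_Cr n p (r : option nat) (W : set 'rV[R]_n)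
    (f : 'rV[R]_n -> 'rV[R]_p) : Prop :=
  exists (U : set 'rV[R]_n) (F : 'rV[R]_n -> 'rV[R]_p),
    [/\ open U, W = U `&` @orthant n, Cr_on r U F &
        forall y, W y -> F y = f y].

Record chart (T : Type) (n : nat) := Chart {
  chart_dom : set T;
  chart_coord : T -> 'rV[R]_n
}.

Definition chart_inv (T : pointedType) n (c : chart T n) (y : 'rV[R]_n) : T :=
  get [set x | chart_dom c x /\ chart_coord c x = y].

(* Continuity of [f] is part of [corner_Cr], through the openness of the domain
   of each coordinate expression of [f]. *)
Definition corner_manifold_Cr (T T' : pointedType) n n' (r : option nat)
    (atl : set (chart T n)) (atl' : set (chart T' n')) (f : T -> T') : Prop :=
  forall c c', atl c -> atl' c' ->
    corner_Cr r (chart_coord c @` (chart_dom c `&` f @^-1` chart_dom c'))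
      (fun y => chart_coord c' (f (chart_inv c y))).

Definition corner_manifold_diffeo (T T' : pointedType) n n' (r : option nat)
    (X : set T) (atl : set (chart T n)) (Y : set T') (atl' : set (chart T' n'))
    (f : T -> T') : Prop :=
  exists h : T' -> T,
    [/\ (forall x, X x -> Y (f x) /\ h (f x) = x),
        (forall y, Y y -> X (h y) /\ f (h y) = y),
        corner_manifold_Cr r atl atl' f & corner_manifold_Cr r atl' atl h].

End Smoothness.

Section Polytopes.
Context {R : realType}.

(* [S] contains d+1, but not d+2, affinely independent points *)
Definition has_dim n (S : set 'rV[R]_n) (d : nat) : Prop :=
  (exists (x : 'rV[R]_n) (D : 'M[R]_(d, n)),
     [/\ S x, (forall i, S (x + row i D)) & row_free D]) /\
  (forall (x : 'rV[R]_n) (D : 'M[R]_(d.+1, n)),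
     S x -> (forall i, S (x + row i D)) -> ~~ row_free D).

Definition is_face n (P G : set 'rV[R]_n) : Prop :=
  exists (c : 'cV[R]_n) (d : R),
    (forall x, P x -> 0 <= (x *m c) 0 0 + d) /\
    G = [set x | P x /\ (x *m c) 0 0 + d = 0].

(* vertices are the 0-dimensional faces *)
Definition is_vertex n (P : set 'rV[R]_n) (v : 'rV[R]_n) : Prop :=
  is_face P [set v].

Definition is_facet n (P G : set 'rV[R]_n) : Prop :=
  is_face P G /\ exists2 d, n = d.+1 & has_dim G d.

Variables m n : nat.
Implicit Types (A : 'M[R]_(m, n)) (b : 'rV[R]_m).

Definition j_map A b (x : 'rV[R]_n) : 'rV[R]_m := x *m A^T + b.

Definition polytope A b : set 'rV[R]_n :=
  [set x | forall i, 0 <= j_map A b x 0 i].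

Definition facet A b (i : 'I_m) : set 'rV[R]_n :=
  [set x | polytope A b x /\ j_map A b x 0 i = 0].

Definition active A b (x : 'rV[R]_n) : {set 'I_m} :=
  [set i | j_map A b x 0 i == 0]%SET.

Record simple_polytope A b : Prop := SimplePolytope {
  polytope_bounded : bounded_set (polytope A b);
  polytope_dim : has_dim (polytope A b) n;
  facet_distinct : injective (facet A b);
  facets_exactly : forall G, is_facet (polytope A b) G <->
                             exists i, G = facet A b i;
  polytope_simple : forall v, is_vertex (polytope A b) v ->
                              #|active A b v| = n
}.

Definition s_map A b (x : 'rV[R]_n) : 'rV[R]_m :=
  \row_k Num.sqrt (j_map A b x 0 k).

Definition s_image A b : set 'rV[R]_m := s_map A b @` polytope A b.

(* [v] is a vertex, and [sigma] enumerates, in some order, the [n] facets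
   meeting at [v] *)
Definition vertex_order A b (v : 'rV[R]_n) (sigma : 'I_n -> 'I_m) : Prop :=
  [/\ is_vertex (polytope A b) v, injective sigma &
      active A b v = [set sigma s | s : 'I_n]%SET].

Definition P_v A b (v : 'rV[R]_n) : set 'rV[R]_n :=
  polytope A b `\` \bigcup_(j in [set j | j \notin active A b v]) facet A b j.

Definition vertex_chart A b v (sigma : 'I_n -> 'I_m) : chart 'rV[R]_m n :=
  Chart (s_map A b @` P_v A b v) (fun r => \row_s r 0 (sigma s)).

(* The quadratic structure on [P] is carried by [s_image], the copy [s_P(P)] of
   [P] in R^m, where the coordinates [R_j = sqrt (a_j x + b_j)] are coordinate
   projections. *)
Definition quadratic_atlas A b : set (chart 'rV[R]_m n) :=
  [set c | exists v sigma,
     vertex_order A b v sigma /\ c = vertex_chart A b v sigma].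

Definition moment_angle A b : set 'rV[R[i]]_m :=
  [set z | (j_map A b @` polytope A b)
             (\row_k (Normc.normc (z 0 k)) ^+ 2)].

Definition real_moment_angle A b : set 'rV[R]_m :=
  [set u | moment_angle A b (map_mx (real_complex R) u)].

End Polytopes.

Definition expi {R : realType} (t : R) : R[i] := Complex (cos t) (sin t).

Definition coord_mul {K : pzRingType} m (t z : 'rV[K]_m) : 'rV[K]_m :=
  \row_k (t 0 k * z 0 k).

Definition torus_equivariant {R : realType} m (X : set 'rV[R[i]]_m)
    (f : 'rV[R[i]]_m -> 'rV[R[i]]_m) : Prop :=
  forall t z : 'rV[R[i]]_m, (forall k, `|t 0 k| = 1) -> X z ->
    f (coord_mul t z) = coord_mul t (f z).

Definition sign_equivariant {R : realType} m (X : set 'rV[R]_m)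
    (f : 'rV[R]_m -> 'rV[R]_m) : Prop :=
  forall e u : 'rV[R]_m, (forall k, e 0 k = 1 \/ e 0 k = -1) -> X u ->
    f (coord_mul e u) = coord_mul e (f u).

(* [f-hat] of a map [g] defined on [s_P(P)] *)
Definition sign_extension {R : realType} m (g : 'rV[R]_m -> 'rV[R]_m)
    (u : 'rV[R]_m) : 'rV[R]_m :=
  \row_k (Num.sg (u 0 k) * g (map_mx Num.norm u) 0 k).

(* Main.v *)
Require Import Defs.
From HB Require Import structures.
From mathcomp Require Import ring lra.

Set Implicit Arguments.
Unset Strict Implicit.
Unset Printing Implicit Defensive.

(** Equivariance determines [f] from its restriction to the real moment-angle
    manifold. There the coordinate [f_k] is odd in [u_k], even in the other [u_l],
    and vanishes exactly where [u_k] does; [g] and [psi] are its modulus and its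
    phase on the section [s(P)], and the induced map of real moment-angle manifolds is
    [sign (u_k) |f_k (u)|].

    Smoothness is only in doubt where [u_k = 0]. A local smooth extension of [f_k] to
    the ambient space can be made odd in [u_k]; it then vanishes on the hyperplane
    [u_k = 0] and factors as [u_k Q], where [Q] is continuous by the mean value theorem
    ([coord_quotient_continuous]). The quotient [Q] does not vanish: since [P] is
    simple, a curve in the manifold crosses [u_k = 0] in the direction [e_k], symmetric
    under the sign change of [u_k] ([crossing_curve]). Along it the coordinates of [f]
    other than the [k]-th are even, so the velocity of its image is [Q e_k], and it is
    nonzero because [f] has a differentiable inverse ([normal_derivative_neq0]).

    Hence [sign (u_k) |f_k| = u_k |Q|]. Although [Q] is only known to be continuous,
    this function is of class C^1, as its differential is [<Q, d f_k> / |Q|]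
    ([C1_signed_norm]). The same holds for the inverse of [f], whose signed modulus
    inverts that of [f] ([sign_extension_cancel]); this is the assertion on the real
    moment-angle manifolds.

    For the quadratic structures, the inverse of a vertex chart extends to negative
    values of the coordinates as a C^1 map into the real moment-angle manifold
    ([chart_param]), so the coordinate expressions of [g] are restrictions of
    compositions of C^1 maps. The normal derivatives vanish because these compositions
    are even in each coordinate other than their own.

    The phase is an argument of the nowhere zero continuous function [Q] on [s(P)].
    Squaring coordinates identifies [s(P)] with the compact convex set [j(P)], where a
    circle-valued map has a continuous argument ([continuous_argument]). *)

(** * Neighbourhoods and continuity at a point *)

Section Neighbourhoods.
Context {R : realType}.

Lemma near_everywhere (T : topologicalType) (P : T -> Prop) (x : T) :
  (forall y, P y) -> \forall y \near x, P y.
Proof. exact: nearW. Qed.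

Lemma near_forall (T : topologicalType) (I : finType) (P : I -> T -> Prop) (x : T) :
  (forall i, \forall y \near x, P i y) -> (\forall y \near x, forall i, P i y).
Proof. exact: filter_forall. Qed.

Lemma near_open (T : topologicalType) (P : T -> Prop) (x : T) :
  (\forall y \near x, P y) ->
  exists U, [/\ open U, U x & forall y, U y -> P y].
Proof.
move=> H; have : nbhs x P by [].
by rewrite nbhsE => -[U [oU Ux] HU]; exists U.
Qed.

Lemma continuous_near_eq (T : topologicalType) (T' : topologicalType) (f g : T -> T') x :
  (\forall y \near x, f y = g y) -> {for x, continuous g} ->
  {for x, continuous f}.
Proof.
move=> fg gc; rewrite /prop_for /continuous_at (nbhs_singleton fg).
apply: cvg_trans gc; apply: near_eq_cvg.
by apply: filterS fg => y ->.
Qed.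

Lemma near_gt (T : topologicalType) (f : T -> R) x a :
  {for x, continuous f} -> a < f x -> \forall y \near x, a < f y.
Proof. by move=> fc; exact: cvgr_gt fc _. Qed.

Lemma near_lt (T : topologicalType) (f : T -> R) x a :
  {for x, continuous f} -> f x < a -> \forall y \near x, f y < a.
Proof. by move=> fc; exact: cvgr_lt fc _. Qed.

Lemma near_neq0 (T : topologicalType) (f : T -> R) x :
  {for x, continuous f} -> f x != 0 -> \forall y \near x, f y != 0.
Proof. by move=> fc; exact: cvgr_neq0 fc. Qed.

Lemma for_continuousP (T : topologicalType) (f : T -> R) x :
  {for x, continuous f} <->
  forall e, 0 < e -> \forall y \near x, `|f x - f y| < e.
Proof. by split=> [/cvgrPdist_lt|?]//; apply/cvgrPdist_lt. Qed.

Lemma for_continuous_cst (T : topologicalType) (a : R) (x : T) :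
  {for x, continuous (fun _ : T => a)}.
Proof. exact: cvg_cst. Qed.

Lemma for_continuous_id (x : R) : {for x, continuous (fun y : R => y)}.
Proof. exact: cvg_id. Qed.

Lemma for_continuousM (T : topologicalType) (f g : T -> R) x :
  {for x, continuous f} -> {for x, continuous g} ->
  {for x, continuous (fun y => f y * g y)}.
Proof. exact: cvgM. Qed.

Lemma for_continuousD (T : topologicalType) (f g : T -> R) x :
  {for x, continuous f} -> {for x, continuous g} ->
  {for x, continuous (fun y => f y + g y)}.
Proof. exact: cvgD. Qed.

Lemma for_continuousV (T : topologicalType) (f : T -> R) x : f x != 0 ->
  {for x, continuous f} -> {for x, continuous (fun y => (f y)^-1)}.
Proof. exact: cvgV. Qed.

Lemma for_continuous_sqrt (T : topologicalType) (f : T -> R) x :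
  {for x, continuous f} -> {for x, continuous (fun y => Num.sqrt (f y))}.
Proof.
move=> fc; apply: (@continuous_comp _ _ _ f (@Num.sqrt R)) => //.
exact: sqrt_continuous.
Qed.

Lemma cvg_within_comp (T T1 T2 : topologicalType) (X : set T) (Y : set T1)
    (g : T -> T1) (f : T1 -> T2) x :
  {for x, continuous g} -> (forall y, X y -> Y (g y)) ->
  f y @[y --> within Y (nbhs (g x))] --> f (g x) ->
  f (g y) @[y --> within X (nbhs x)] --> f (g x).
Proof.
move=> gc XY fc; apply: (@cvg_comp _ _ _ g f _ (within Y (nbhs (g x)))) => //.
move=> U UY; have H : \forall y \near x, Y (g y) -> U (g y) := gc _ UY.
change (\forall y \near x, X y -> U (g y)).
by apply: filterS H => y Hy Xy; apply: Hy; exact: XY.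
Qed.

Lemma within_near_eq (T T1 : topologicalType) (X : set T) (f g : T -> T1) x :
  X x -> {for x, continuous g} -> (\forall y \near x, X y -> f y = g y) ->
  f y @[y --> within X (nbhs x)] --> f x.
Proof.
move=> Xx gc fg; rewrite (nbhs_singleton fg Xx).
move=> U Ug; have H : \forall y \near x, U (g y) := gc _ Ug.
change (\forall y \near x, X y -> U (f y)).
by apply: filterS2 fg H => y E Uy Xy; rewrite E.
Qed.

Lemma eq_of_punctured (a b : R -> R) :
  {for 0, continuous a} -> {for 0, continuous b} ->
  (\forall t \near (0 : R), t != 0 -> a t = b t) -> a 0 = b 0.
Proof.
move=> ac bc E; apply/eqP; rewrite -subr_eq0; apply/negPn/negP => ab.
have abc : {for (0 : R), continuous (fun t => a t - b t)}.
  by apply: cvgB.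
have H : \forall t \near (0 : R), t != 0 -> False.
  apply: filterS2 E (near_neq0 abc ab) => t Et; rewrite subr_eq0 => /eqP nab t0.
  exact/nab/Et.
have /nbhs_ballP[e /= e0 He] := H.
have e2 : 0 < e / 2 by rewrite divr_gt0.
apply: (He (e / 2)); last by rewrite gt_eqF.
by rewrite -ball_normE /= sub0r normrN gtr0_norm // ltr_pdivrMr // ltr_pMr // ltr1n.
Qed.

End Neighbourhoods.

(** * Differentials *)

Section Differentials.
Context {R : realType}.
Implicit Types V W : normedModType R.

Lemma is_diff_of_littleo V W (f : V -> W) (df : {linear V -> W}) x :
  continuous df -> f \o shift x = cst (f x) + df +o_ 0 id ->
  is_diff x f df.
Proof.
move=> dfc fE; have E : 'd f x = df :> (V -> W) by exact: diff_unique.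
by split=> //; apply/diff_locallyP; rewrite E.
Qed.

Lemma is_diff_near_eq V W (f g : V -> W) df x :
  (\forall y \near x, f y = g y) -> is_diff x g df -> is_diff x f df.
Proof.
move=> fg [dg <-]; apply: is_diff_of_littleo; first exact: diff_continuous.
apply/eqaddoP => e e0; have /eqaddoP /(_ e e0) := diff_locally dg.
have : \forall h \near (0 : V), f (h + x) = g (h + x).
  have := fg; rewrite -[in X in X -> _](add0r x).
  rewrite (near_shift 0) subr0 add0r.
  by apply: filterS => h /=.
apply: filterS2 => h /= fgh.
by rewrite !fctE /= fgh (nbhs_singleton fg).
Qed.

Lemma is_diff_linear (V W : normedModType R) (L : {linear V -> W}) x :
  continuous L -> is_diff x L L.
Proof. by move=> Lc; split; [exact: linear_differentiable | exact: diff_lin]. Qed.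

Lemma is_diff_coord m n (M : 'M[R]_(m, n)) i j :
  is_diff M (fun N : 'M[R]_(m, n) => N i j : R) (fun N => N i j).
Proof.
have lin : linear (fun N : 'M[R]_(m, n) => N i j : R) by move=> a N N'; rewrite !mxE.
pose L : {linear 'M[R]_(m, n) -> R} := HB.pack (fun N : 'M[R]_(m, n) => N i j : R)
  (GRing.isLinear.Build _ _ _ _ _ lin).
by apply: (is_diff_linear (L := L)); exact: coord_continuous.
Qed.

Lemma is_diff_sum V W n (F dF : 'I_n -> V -> W) x :
  (forall i, is_diff x (F i) (dF i)) ->
  is_diff x (\sum_i F i) (\sum_i dF i).
Proof.
move=> FC.
apply: (big_ind2 (fun (f df : V -> W) => is_diff x f df)).
- exact: is_diff_cst.
- by move=> f df g dg; exact: is_diffD.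
- by move=> i _; exact: FC.
Qed.

Lemma is_diff_row V n (F dF : V -> 'rV[R]_n) x :
  (forall i, is_diff x (fun y => F y 0 i) (fun y => dF y 0 i)) ->
  is_diff x F dF.
Proof.
move=> FC.
have -> : F = \sum_i (fun y => F y 0 i *: delta_mx 0 i).
  by apply/funext => y; rewrite fct_sumE -row_sum_delta.
have -> : dF = \sum_i (fun y => dF y 0 i *: delta_mx 0 i).
  by apply/funext => y; rewrite fct_sumE -row_sum_delta.
apply: is_diff_sum => i.
pose L := fun r : R => r *: (delta_mx 0 i : 'rV[R]_n).
have HL (y : R) : is_diff y L L by exact: is_diff_scalel.
have := @is_diff_comp _ _ _ _ _ _ _ _ _ (FC i) (HL _).
exact.
Qed.

Lemma is_diff_line V (z w : V) (t : R) :
  is_diff t (fun s => z + s *: w) (fun s => s *: w).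
Proof.
have H := is_diffD (is_diff_cst z t) (is_diff_scalel t w).
by rewrite add0r in H.
Qed.

Lemma is_diff_sqrt (x : R) : 0 < x ->
  is_diff x (@Num.sqrt R) (fun v => v * (2 * Num.sqrt x)^-1).
Proof.
move=> x0; have [dx Dx] := is_derive1_sqrt x0.
split; first exact/derivable1_diffP.
by rewrite diff1E ?derive1E ?Dx //; exact/derivable1_diffP.
Qed.

Lemma is_diff_sum_sqr V (p1 p2 d1 d2 : V -> R) x :
  is_diff x p1 d1 -> is_diff x p2 d2 ->
  is_diff x (fun z => p1 z ^+ 2 + p2 z ^+ 2)
    (fun v => 2 * (p1 x * d1 v + p2 x * d2 v)).
Proof.
move=> D1 D2; have X1 := @is_diffX R _ p1 _ 1 x D1.
have X2 := @is_diffX R _ p2 _ 1 x D2.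
apply: is_diff_eq (is_diffD X1 X2) _; apply/funext => v.
by rewrite !fctE /GRing.scale /= !expr1; ring.
Qed.

(** Where [l] vanishes, the variation of [c] only contributes to second order, so [c]
    need not be differentiable for the product to be. *)
Lemma is_diff_mul_vanish V (l dl c : V -> R) x :
  is_diff x l dl -> l x = 0 -> {for x, continuous c} ->
  is_diff x (fun y => l y * c y) (fun v => dl v * c x).
Proof.
move=> lD l0 cc.
have H0 : is_diff x (fun y => l y * (c y - c x)) (0 : V -> R).
  apply: (is_diff_of_littleo (df := \0 : {linear V -> R})).
    by move=> ?; exact: cvg_cst.
  apply/eqaddoP => e e0.
  have [ld _] := lD; have [K K0 HK] := linear_lipschitz (diff_continuous ld).
  have /eqaddoP /(_ 1 ltr01) lE := diff_locally ld.
  have K1 : 0 < K + 1 by rewrite addr_gt0.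
  have cE : \forall h \near (0 : V), `|c (h + x) - c x| < e / (K + 1).
    have /cvgrPdist_lt /(_ _ (divr_gt0 e0 K1)) H := cc.
    rewrite (near_shift x) sub0r; apply: filterS H => y /=.
    by rewrite distrC subrK.
  apply: filterS2 lE cE => h; rewrite !fctE /= l0 mul1r add0r => lE cE.
  rewrite mul0r add0r subr0 normrM.
  have lE' : `|l (h + x)| <= (K + 1) * `|h|.
    rewrite mulrDl mul1r -[X in `|X|](subrK ('d l x h)) addrC.
    by rewrite (le_trans (ler_normD _ _)) // lerD.
  rewrite (le_trans (ler_pM _ _ lE' (ltW cE))) //.
  by rewrite mulrC mulrA divfK // gt_eqF.
have -> : (fun y => l y * c y) = (c x *: l) + (fun y => l y * (c y - c x)).
  by apply/funext => y; rewrite !fctE /GRing.scale /=; ring.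
have -> : (fun v => dl v * c x) = (c x *: dl) + 0.
  by rewrite addr0; apply/funext => y; rewrite !fctE /GRing.scale /= mulrC.
by apply: is_diffD; apply: is_diffZ.
Qed.

(** Kills the derivatives of the coordinates that are even in [u_k]. *)
Lemma even_diff0 (W : normedModType R) (p : R -> W) dp :
  is_diff 0 p dp -> (\forall s \near (0 : R), p (- s) = p s) -> dp 1 = 0.
Proof.
move=> Hp He.
have HN : is_diff (0 : R) (fun s : R => - s) (fun s => - s).
  exact: (is_diffN (is_diff_id (0 : R))).
have H : is_diff (0 : R) (p \o (fun s => - s)) (dp \o (fun s => - s)).
  by apply: is_diff_comp; rewrite oppr0.
have [_ E1] := is_diff_near_eq He Hp; have [_ E2] := H; have [_ E3] := Hp.
have : dp 1 = dp (- 1) by rewrite -[LHS]/((_ : R -> W) 1) -{1}E1 E2.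
rewrite -E3 linearN => /eqP; rewrite -subr_eq0 opprK -mulr2n -scaler_nat.
by rewrite scaler_eq0 pnatr_eq0 /= => /eqP.
Qed.

Lemma mean_value_segment V (phi : V -> R) z w :
  (forall t : R, 0 <= t <= 1 -> differentiable phi (z + t *: w)) ->
  exists2 t, 0 <= t <= 1 & phi (z + w) - phi z = 'd phi (z + t *: w) w.
Proof.
move=> Hd; pose g t := phi (z + t *: w).
have gD (t : R) : 0 <= t <= 1 -> is_diff t g (fun s => 'd phi (z + t *: w) (s *: w)).
  move=> /Hd/differentiableP t01.
  exact: (@is_diff_comp _ _ _ _ _ _ _ _ _ (is_diff_line z w t) t01).
have [||t t01 E] := @MVT_segment R g (fun t => 'd phi (z + t *: w) w) 0 1 ler01.
- move=> t; rewrite in_itv /= => /andP[t0 t1].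
  have t01 : 0 <= t <= 1 by rewrite !ltW.
  have [dg Dg] := gD _ t01.
  by split; [exact/derivable1_diffP | rewrite deriveE // Dg scale1r].
- apply: continuous_in_subspaceT => t; rewrite inE /= in_itv /= => t01.
  by apply: differentiable_continuous; have [] := gD _ t01.
exists t; first by rewrite in_itv in t01.
by move: E; rewrite /g scale1r scale0r addr0 subr0 mulr1.
Qed.

End Differentials.

(** * Maps of class C^1 *)

Section ContinuouslyDifferentiable.
Context {R : realType}.
Implicit Types V W : normedModType R.

(** A condition on a whole neighbourhood, so that it passes to nearby points and the
    chain rule can be applied there. *)
Definition C1 V W (F : V -> W) (x : V) : Prop :=
  \forall y \near x, differentiable F y /\
    forall v, {for y, continuous (fun z => 'd F z v)}.

Lemma C1_open V W (U : set V) (F : V -> W) : open U ->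
  Cr_on (Some 1%N) U F <-> forall x, U x -> C1 F x.
Proof.
move=> oU; split=> [[Fd Fc] x Ux|FC1].
  have : \forall y \near x, U y by exact: open_nbhs_nbhs.
  by apply: filterS => y Uy; split=> [|v]; [exact: Fd | exact: Fc].
split=> [x /FC1 /nbhs_singleton []// | v x /FC1 /nbhs_singleton [_ ]]; exact.
Qed.

Lemma C1_near V W (F : V -> W) x : C1 F x -> \forall y \near x, C1 F y.
Proof. exact: near_join. Qed.

(** It suffices to exhibit a continuous formula for the differential. *)
Lemma C1_intro V W (F : V -> W) (dF : V -> V -> W) x :
  (\forall y \near x, is_diff y F (dF y) /\
     forall v, {for y, continuous (fun z => dF z v)}) -> C1 F x.
Proof.
move=> /near_join H; apply: filterS H => y Fy; split.
  by have [[]] := nbhs_singleton Fy.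
move=> v; apply: (@continuous_near_eq _ _ _ (fun z => dF z v)).
  by apply: filterS Fy => z [[_ ->]].
by have [_] := nbhs_singleton Fy; apply.
Qed.

Lemma C1_is_diff V W (F : V -> W) x : C1 F x ->
  \forall y \near x, is_diff y F ('d F y) /\
     forall v, {for y, continuous (fun z => 'd F z v)}.
Proof. by apply: filterS => y [Fd Fc]; split=> //; exact: differentiableP. Qed.

Lemma C1_differentiable V W (F : V -> W) x : C1 F x -> differentiable F x.
Proof. by move=> /nbhs_singleton []. Qed.

Lemma C1_continuous V W (F : V -> W) x : C1 F x -> {for x, continuous F}.
Proof. by move=> /C1_differentiable; exact: differentiable_continuous. Qed.

Lemma C1_near_eq V W (F G : V -> W) x :
  (\forall y \near x, F y = G y) -> C1 G x -> C1 F x.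
Proof.
move=> /near_join FG /C1_is_diff GC; apply: C1_intro.
apply: filterS2 FG GC => y FG [Gd Gc]; split; last exact: Gc.
exact: is_diff_near_eq FG Gd.
Qed.

Lemma C1_cst V W (a : W) x : C1 (cst a : V -> W) x.
Proof.
apply: (@C1_intro V W _ (fun _ _ => 0)); apply: nearW => y; split.
  exact: is_diff_cst.
by move=> v; exact: cvg_cst.
Qed.

Lemma C1_linear V W (L : V -> W) x : (forall y, is_diff y L L) -> C1 L x.
Proof.
move=> HL; apply: (@C1_intro _ _ _ (fun=> L)); apply: nearW => y; split=> //.
by move=> v; exact: cvg_cst.
Qed.

(** The middle space is finite dimensional because continuity of the differential is
    known one direction at a time: the chain rule is expanded along a basis. *)
Lemma C1_comp V W n (F : V -> 'rV[R]_n) (G : 'rV[R]_n -> W) x :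
  C1 F x -> C1 G (F x) -> C1 (G \o F) x.
Proof.
move=> FC GC; have Fc := C1_continuous FC.
apply: (@C1_intro _ _ _ (fun y v => \sum_i ('d F y v) 0 i *: 'd G (F y) (delta_mx 0 i))).
have : \forall y \near x, C1 G (F y) by have := Fc _ (C1_near GC).
apply: filterS2 (C1_near FC) => y Fy Gy; split.
  apply: (@is_diff_eq _ _ _ _ ('d G (F y) \o 'd F y)).
  + apply: is_diff_comp; first by apply: differentiableP; exact: C1_differentiable.
    by apply: differentiableP; exact: C1_differentiable.
  + apply/funext => v /=; rewrite [in LHS](row_sum_delta ('d F y v)) linear_sum.
    by apply: eq_bigr => i _; rewrite linearZ.
move=> v; apply: (cvg_big (op := +%R)) => [|i _]; first exact: add_continuous.
  apply: cvgZ.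
- have [_ /(_ v) H] := nbhs_singleton Fy.
  by apply: (@continuous_comp _ _ _ (fun z => 'd F z v)
    (fun M : 'rV[R]_n => M 0 i)); [exact: H | exact: coord_continuous].
- have [_ /(_ (delta_mx 0 i)) H] := nbhs_singleton Gy.
  apply: (@continuous_comp _ _ _ F (fun z => 'd G z (delta_mx 0 i))); last exact: H.
  exact: C1_continuous.
Qed.

Lemma C1_compR V W (F : V -> R) (G : R -> W) x :
  C1 F x -> C1 G (F x) -> C1 (G \o F) x.
Proof.
move=> FC GC; have Fc := C1_continuous FC.
apply: (@C1_intro _ _ _ (fun y v => ('d F y v) *: 'd G (F y) 1)).
have : \forall y \near x, C1 G (F y) by have := Fc _ (C1_near GC).
apply: filterS2 (C1_near FC) => y Fy Gy; split.
  apply: (@is_diff_eq _ _ _ _ ('d G (F y) \o 'd F y)).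
  + apply: is_diff_comp; first by apply: differentiableP; exact: C1_differentiable.
    by apply: differentiableP; exact: C1_differentiable.
  + by apply/funext => v /=; rewrite -linearZ /= /GRing.scale /= mulr1.
move=> v; apply: cvgZ.
- by have [_ /(_ v) H] := nbhs_singleton Fy.
- have [_ /(_ 1) H] := nbhs_singleton Gy.
  apply: (@continuous_comp _ _ _ F (fun z => 'd G z 1)); last exact: H.
  exact: C1_continuous.
Qed.

Lemma C1_comp_linearr V V' W (L : V -> V') (G : V' -> W) x :
  (forall y, is_diff y L L) -> C1 G (L x) -> C1 (G \o L) x.
Proof.
move=> HL GC; have Lc y : {for y, continuous L}.
  by apply: differentiable_continuous; have [] := HL y.
apply: (@C1_intro _ _ _ (fun y v => 'd G (L y) (L v))).
have : \forall y \near x, C1 G (L y) by have := Lc x _ (C1_near GC).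
apply: filterS => y Gy; split.
  have dG : is_diff (L y) G ('d G (L y)).
    by apply: differentiableP; exact: C1_differentiable.
  exact: is_diff_comp.
move=> v; apply: (@continuous_comp _ _ _ L (fun z => 'd G z (L v))) => //.
by have [_] := nbhs_singleton Gy; apply.
Qed.

Lemma C1_comp_linearl V W W' (F : V -> W) (L : W -> W') x :
  (forall y, is_diff y L L) -> C1 F x -> C1 (L \o F) x.
Proof.
move=> HL FC; have Lc y : {for y, continuous L}.
  by apply: differentiable_continuous; have [] := HL y.
apply: (@C1_intro _ _ _ (fun y v => L ('d F y v))).
apply: filterS FC => y [Fd Fc]; split; last first.
  by move=> v; apply: (@continuous_comp _ _ _ (fun z => 'd F z v)) => //; exact: Fc.
by apply: is_diff_comp; apply: differentiableP.
Qed.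

Lemma C1_add V W (F G : V -> W) x : C1 F x -> C1 G x -> C1 (F + G) x.
Proof.
move=> /C1_is_diff FC /C1_is_diff GC.
apply: (@C1_intro V W _ (fun y v => 'd F y v + 'd G y v)).
apply: filterS2 FC GC => y [Fd Fc] [Gd Gc]; split; first exact: is_diffD.
by move=> v; apply: cvgD; [exact: Fc | exact: Gc].
Qed.

Lemma C1_sub V W (F G : V -> W) x : C1 F x -> C1 G x -> C1 (F - G) x.
Proof.
move=> /C1_is_diff FC /C1_is_diff GC.
apply: (@C1_intro V W _ (fun y v => 'd F y v - 'd G y v)).
apply: filterS2 FC GC => y [Fd Fc] [Gd Gc]; split; first exact: is_diffB.
by move=> v; apply: cvgB; [exact: Fc | exact: Gc].
Qed.

Lemma C1_scale V W k (F : V -> W) x : C1 F x -> C1 (k *: F) x.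
Proof. by apply: (C1_comp_linearl (L := *:%R k)). Qed.

Lemma C1_sum V W n (F : 'I_n -> V -> W) x :
  (forall i, C1 (F i) x) -> C1 (\sum_i F i) x.
Proof.
move=> FC; apply: (big_ind (fun f : V -> W => C1 f x)).
- exact: C1_cst.
- by move=> f g; exact: C1_add.
- by move=> i _; exact: FC.
Qed.

Lemma C1_coord V m n (F : V -> 'M[R]_(m, n)) x i j :
  C1 F x -> C1 (fun y => F y i j) x.
Proof.
by apply: (C1_comp_linearl (L := fun N : 'M[R]_(m, n) => N i j : R)) => y;
   exact: is_diff_coord.
Qed.

Lemma C1_row V n (F : V -> 'rV[R]_n) x :
  (forall i, C1 (fun y => F y 0 i) x) -> C1 F x.
Proof.
move=> FC.
have -> : F = \sum_i (fun y => F y 0 i *: delta_mx 0 i).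
  by apply/funext => y; rewrite fct_sumE -row_sum_delta.
apply: C1_sum => i.
pose L := fun r : R => r *: (delta_mx 0 i : 'rV[R]_n).
have HL (y : R) : is_diff y L L by exact: is_diff_scalel.
have := C1_comp_linearl HL (FC i).
exact.
Qed.

Lemma C1_mulmxr V n p (F : V -> 'rV[R]_n) (M : 'M[R]_(n, p)) x :
  C1 F x -> C1 (fun y => F y *m M) x.
Proof.
move=> FC; apply: C1_row => i.
have -> : (fun y => (F y *m M) 0 i) = \sum_s (M s i *: (fun y => F y 0 s)).
  by apply/funext => y; rewrite fct_sumE mxE; apply: eq_bigr => s _; rewrite mulrC.
by apply: C1_sum => s; apply: C1_scale; exact: C1_coord.
Qed.

Lemma C1_id V (x : V) : C1 (fun y => y) x.
Proof. by apply: C1_linear => y; exact: is_diff_id. Qed.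

Lemma C1_sqrt (x : R) : 0 < x -> C1 (@Num.sqrt R) x.
Proof.
move=> x0; have x0' : \forall y \near x, 0 < y by apply: (near_gt (f := id)).
apply: (@C1_intro R R (@Num.sqrt R) (fun y v => v * (2 * Num.sqrt y)^-1)).
apply: filterS x0' => y y0; split; first exact: is_diff_sqrt.
move=> v; apply: cvgM; first exact: cvg_cst.
apply: cvgV; first by rewrite mulf_neq0 // gt_eqF // sqrtr_gt0.
by apply: cvgM; [exact: cvg_cst | exact: sqrt_continuous].
Qed.

End ContinuouslyDifferentiable.

(** * Division by a coordinate *)

Section Hadamard.
Context {R : realType}.
Implicit Types V W : normedModType R.

Section Quotient.
Variables (m : nat) (k : 'I_m).
Implicit Types (phi : 'rV[R]_m -> R) (x u : 'rV[R]_m).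

(** For a function vanishing on the hyperplane, the continuous extension of its quotient
    by the [k]-th coordinate. *)
Definition coord_quotient phi x : R :=
  if x 0 k == 0 then 'd phi x (delta_mx 0 k) else phi x / x 0 k.

Lemma coord_quotientE phi x : (x 0 k = 0 -> phi x = 0) ->
  phi x = x 0 k * coord_quotient phi x.
Proof.
rewrite /coord_quotient; case: eqVneq => [-> ->//|x0 _]; first by rewrite mul0r.
by rewrite mulrC divfK.
Qed.

(** By the mean value theorem along the [k]-th coordinate, the quotient at [y] is the
    partial derivative of [phi] at a point between [y] and its projection to the
    hyperplane, and such points tend to [x] with [y]. *)
Lemma coord_quotient_continuous phi x : C1 phi x ->
  (\forall y \near x, (y : 'rV[R]_m) 0 k = 0 -> phi y = 0) ->
  {for x, continuous (coord_quotient phi)}.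
Proof.
move=> phiC phi0; have [xk|xk] := eqVneq (x 0 k) 0; last first.
  apply: (@continuous_near_eq _ _ _ (fun y : 'rV[R]_m => phi y / y 0 k)); last first.
    apply: for_continuousM; first exact: C1_continuous.
    by apply: for_continuousV => //; exact: coord_continuous.
  have : \forall y \near x, (y : 'rV[R]_m) 0 k != 0.
    exact: near_neq0 (@coord_continuous _ _ _ 0 k x) xk.
  by apply: filterS => y yk; rewrite /coord_quotient (negbTE yk).
apply/for_continuousP => e e0; have [_ /(_ (delta_mx 0 k))] := nbhs_singleton phiC.
move=> /for_continuousP /(_ e e0) dE.
have : \forall y \near x, [/\ differentiable phi y, (y 0 k = 0 -> phi y = 0) &
    `|'d phi x (delta_mx 0 k) - 'd phi y (delta_mx 0 k)| < e].
  by apply: filterS3 phiC phi0 dE => y [dy _] ? ?; split.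
move=> /nbhs_ballP[r /= r0 Hr]; apply/nbhs_ballP; exists r => // y xy /=.
rewrite {1}/coord_quotient xk eqxx /coord_quotient.
have [yk|yk] := eqVneq (y 0 k) 0; first by have [] := Hr _ xy.
(* [y - w] is the projection of [y] to the hyperplane. *)
pose w := y 0 k *: (delta_mx 0 k : 'rV[R]_m).
have seg (t : R) : 0 <= t <= 1 -> ball x r (y - w + t *: w).
  move=> /andP[t0 t1]; case: xy => _ xy; split=> // i j; rewrite ord1 {i}.
  rewrite !mxE eqxx /=; case: eqVneq => [->|jk]; last first.
    by rewrite !mulr0 subr0 addr0; exact: xy.
  move: (xy 0 k); rewrite -!ball_normE /= xk !sub0r !normrN mulr1 subrr add0r.
  by apply: le_lt_trans; rewrite normrM ger0_norm // ler_piMl.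
have [t t01|t t01] := mean_value_segment (phi := phi) (z := y - w) (w := w).
  by have [] := Hr _ (seg t t01).
rewrite subrK; have -> : phi (y - w) = 0.
  have [|_ -> //] := Hr (y - w).
    by have := seg 0; rewrite scale0r addr0; apply; rewrite lexx ler01.
  by rewrite !mxE !eqxx mulr1 subrr.
have [_ _ close] := Hr _ (seg t t01).
rewrite subr0 => ->; have dw : 'd phi (y - w + t *: w) w =
    y 0 k * 'd phi (y - w + t *: w) (delta_mx 0 k) by rewrite linearZ.
have div_eq (a b c : R) : c != 0 -> a = c * b -> a / c = b.
  by move=> c0 ->; rewrite mulrC mulKf.
by rewrite (div_eq _ _ _ yk dw).
Qed.

Variables (phi1 phi2 Q1 Q2 : 'rV[R]_m -> R) (u0 : 'rV[R]_m).

(** The differential is [<Q, dphi> / |Q|] at every point. Off the hyperplane this is the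
    derivative of the norm of [phi], up to the sign of the coordinate; on it,
    [dphi v = v_k Q], and the formula becomes [v_k |Q|]. The formula is continuous as
    soon as [Q] is. *)
Lemma C1_signed_norm :
  C1 phi1 u0 -> C1 phi2 u0 ->
  (\forall y \near u0, phi1 y = (y : 'rV[R]_m) 0 k * Q1 y /\ phi2 y = y 0 k * Q2 y) ->
  (\forall y \near u0, {for y, continuous Q1} /\ {for y, continuous Q2}) ->
  0 < Q1 u0 ^+ 2 + Q2 u0 ^+ 2 ->
  C1 (fun y : 'rV[R]_m => y 0 k * Num.sqrt (Q1 y ^+ 2 + Q2 y ^+ 2)) u0.
Proof.
move=> C1phi C2phi phiE Qc Q0.
pose S y := Q1 y ^+ 2 + Q2 y ^+ 2.
have SC y : {for y, continuous Q1} /\ {for y, continuous Q2} ->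
    {for y, continuous S}.
  by move=> [c1 c2]; apply: for_continuousD; apply: for_continuousM.
have S0 : \forall y \near u0, 0 < S y.
  exact: near_gt (SC u0 (nbhs_singleton Qc)) Q0.
apply: (@C1_intro _ _ _ _ (fun y v =>
  (Q1 y * 'd phi1 y v + Q2 y * 'd phi2 y v) / Num.sqrt (S y))).
have H1 := C1_is_diff C1phi; have H2 := C1_is_diff C2phi.
have H3 := near_join phiE.
have H4 : \forall y \near u0, 0 < S y /\
    ({for y, continuous Q1} /\ {for y, continuous Q2}).
  by apply: filterS2 S0 Qc.
have H5 : \forall y \near u0, (is_diff y phi1 ('d phi1 y) /\
     forall v, {for y, continuous (fun z => 'd phi1 z v)}) /\
   (is_diff y phi2 ('d phi2 y) /\
     forall v, {for y, continuous (fun z => 'd phi2 z v)}).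
  by apply: filterS2 H1 H2 => y e1 e2; split; [exact: e1 | exact: e2].
apply: filterS3 H3 H4 H5 => y phiEy [Sy [c1 c2]] [[D1 K1] [D2 K2]].
have Sc : {for y, continuous (fun z => Num.sqrt (S z))}.
  by apply: for_continuous_sqrt; exact: SC.
have Sy' : Num.sqrt (S y) != 0 by rewrite gt_eqF // sqrtr_gt0.
split; last first.
  move=> v; apply: for_continuousM; last exact: for_continuousV.
  apply: for_continuousD; apply: for_continuousM.
  - exact: c1.
  - exact: K1.
  - exact: c2.
  - exact: K2.
have [yk|yk] := eqVneq (y 0 k) 0.
  have Dk : is_diff y (fun z : 'rV[R]_m => z 0 k) (fun z => z 0 k).
    exact: is_diff_coord.
  have E1 : 'd phi1 y = (fun v => v 0 k * Q1 y) :> (_ -> _).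
    have := is_diff_mul_vanish Dk yk c1.
    case/(is_diff_near_eq (_ : \forall z \near y, phi1 z = _)) => //.
    by apply: filterS phiEy => z [].
  have E2 : 'd phi2 y = (fun v => v 0 k * Q2 y) :> (_ -> _).
    have := is_diff_mul_vanish Dk yk c2.
    case/(is_diff_near_eq (_ : \forall z \near y, phi2 z = _)) => //.
    by apply: filterS phiEy => z [].
  apply: is_diff_eq (is_diff_mul_vanish Dk yk Sc) _.
  apply/funext => v; rewrite E1 E2; apply: (mulIf Sy').
  rewrite divfK // -mulrA -expr2 sqr_sqrtr ?ltW // /S; ring.
(* Off the hyperplane the function is [sqrt T] up to a locally constant sign. *)
pose T z := phi1 z ^+ 2 + phi2 z ^+ 2.
have TE : \forall z \near y, T z = (z : 'rV[R]_m) 0 k ^+ 2 * S z.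
  by apply: filterS phiEy => z [e1 e2]; rewrite /T /S e1 e2; ring.
have T0 : 0 < T y.
  by rewrite (nbhs_singleton TE) mulr_gt0 // exprn_even_gt0.
have DT : is_diff y T (fun v => 2 * (phi1 y * 'd phi1 y v + phi2 y * 'd phi2 y v)).
  exact: is_diff_sum_sqr D1 D2.
have DS : is_diff y (fun z : 'rV[R]_m => Num.sg (y 0 k) * Num.sqrt (T z))
    (fun v => Num.sg (y 0 k) * (2 * (phi1 y * 'd phi1 y v + phi2 y * 'd phi2 y v) *
       (2 * Num.sqrt (T y))^-1)).
  have H := is_diff_comp DT (is_diff_sqrt T0).
  exact: is_diff_comp H (is_diff_scaler (Num.sg (y 0 k)) _).
have sgE : \forall z \near y, (z : 'rV[R]_m) 0 k = Num.sg (y 0 k) * `|z 0 k|.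
  have yc := @coord_continuous R _ _ 0 k y.
  have [y0|y0] := ltP 0 (y 0 k).
    apply: filterS (near_gt yc y0) => z z0; rewrite gtr0_sg // gtr0_norm //.
    by rewrite mul1r.
  have {}y0 : y 0 k < 0 by rewrite lt_neqAle yk.
  apply: filterS (near_lt yc y0) => z z0; rewrite ltr0_sg // ltr0_norm //.
  by rewrite mulrNN mul1r.
have sqE (z : 'rV[R]_m) : T z = z 0 k ^+ 2 * S z -> Num.sqrt (T z) = `|z 0 k| * Num.sqrt (S z).
  by move=> ->; rewrite sqrtrM ?sqr_ge0 // sqrtr_sqr.
apply: (is_diff_near_eq (g := fun z => Num.sg (y 0 k) * Num.sqrt (T z))).
  by apply: filterS2 TE sgE => z /sqE -> E; rewrite {1}E mulrA.
apply: is_diff_eq DS _; apply/funext => v; rewrite (sqE _ (nbhs_singleton TE)).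
have [-> ->] := nbhs_singleton phiEy.
have Ey := nbhs_singleton sgE.
have ny : `|y 0 k| != 0 by rewrite normr_eq0.
have sg2 : Num.sg (y 0 k) * Num.sg (y 0 k) = 1 by rewrite -expr2 sqr_sg yk.
have alg (y0 s a q1 q2 d1 d2 r : R) : y0 = s * a -> s * s = 1 -> a != 0 ->
    r != 0 -> s * (2 * (y0 * q1 * d1 + y0 * q2 * d2) * (2 * (a * r))^-1) =
    (q1 * d1 + q2 * d2) / r.
  move=> -> ss a0 r0.
  transitivity (s * s * ((q1 * d1 + q2 * d2) / r)); first by field; rewrite r0.
  by rewrite ss mul1r.
exact: alg Ey sg2 ny Sy'.
Qed.

End Quotient.
End Hadamard.

(** * Vertices and edges of a simple polytope *)

Section PolytopeGeometry.
Context {R : realType}.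
Variables (m n : nat) (A : 'M[R]_(m, n)) (b : 'rV[R]_m).
Implicit Types (x v d w : 'rV[R]_n) (i k l : 'I_m).

Local Notation P := (polytope A b).
Local Notation j := (j_map A b).
Local Notation slope d i := ((d *m A^T) 0 i).

Lemma j_map_line x d (t : R) i : j (x + t *: d) 0 i = j x 0 i + t * slope d i.
Proof. by rewrite /j_map mulmxDl -scalemxAl !mxE addrAC. Qed.

Lemma mem_active x i : (i \in active A b x) = (j x 0 i == 0).
Proof. by rewrite inE. Qed.

Lemma C1_j_map x : C1 j x.
Proof.
by apply: (C1_add (F := fun y => y *m A^T)); [apply: C1_mulmxr; exact: C1_id | exact: C1_cst].
Qed.

Lemma j_map_continuous x i : {for x, continuous (fun y => j y 0 i)}.
Proof. by apply: C1_continuous; apply: C1_coord; exact: C1_j_map. Qed.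

(** Otherwise [v] could be moved both ways along [d] inside the polytope. A face
    functional, nonnegative on the polytope and zero at [v], would vanish on the whole
    segment, whereas it vanishes at [v] only. *)
Lemma vertex_normals_span v d : is_vertex P v ->
  (forall i, i \in active A b v -> slope d i = 0) -> d = 0.
Proof.
move=> [c [d0 [Hge Heq]]] Hd.
have [Pv zv] : P v /\ (v *m c) 0 0 + d0 = 0.
  by have : [set v] v by []; rewrite Heq.
(* Near [v] only the active constraints could fail, and they are constant along [d]. *)
have Hi i : \forall t \near (0 : R), 0 <= j (v + t *: d) 0 i.
  have [iv|iv] := boolP (i \in active A b v).
    have Hall (t : R) : 0 <= j (v + t *: d) 0 i by rewrite j_map_line Hd // mulr0 addr0.
    exact: (near_everywhere _ Hall).
  have j0 : 0 < j v 0 i by rewrite lt_neqAle Pv eq_sym -mem_active iv.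
  have c1 : {for (0 : R), continuous (fun t : R => j v 0 i + t * slope d i)}.
    apply: for_continuousD; first exact: for_continuous_cst.
    by apply: for_continuousM; [exact: for_continuous_id | exact: for_continuous_cst].
  have := near_gt (a := 0) c1; rewrite mul0r addr0 => /(_ j0).
  by apply: filterS => t t0; rewrite j_map_line ltW.
have /nbhs_ballP[e /= e0 He] := near_forall Hi.
have Ht (t : R) : `|t| < e -> P (v + t *: d).
  by move=> te i; apply: He; rewrite -ball_normE /= sub0r normrN.
have e2 : `|e / 2| < e by rewrite gtr0_norm ?divr_gt0 // ltr_pdivrMr // ltr_pMr // ltr1n.
have H1 := Hge _ (Ht _ e2).
have H2 : 0 <= ((v + (- (e / 2)) *: d) *m c) 0 0 + d0.
  by apply: Hge; apply: Ht; rewrite normrN.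
have E (t : R) : ((v + t *: d) *m c) 0 0 + d0 = t * (d *m c) 0 0.
  by rewrite mulmxDl -scalemxAl mxE [X in _ + X + _]mxE addrAC zv add0r.
rewrite E in H1; rewrite E mulNr oppr_ge0 in H2.
have H : [set v] (v + (e / 2) *: d).
  rewrite Heq; split; first exact: Ht.
  by rewrite E; apply/eqP; rewrite eq_le H1 H2.
move: H => /= /eqP; rewrite -subr_eq0 addrAC subrr add0r scaler_eq0.
by rewrite mulf_eq0 invr_eq0 pnatr_eq0 orbF gt_eqF //= => /eqP.
Qed.

(** The sum of the constraints active at [v] is a face functional that vanishes at [v]
    only. *)
Lemma vertex_of_span v : P v ->
  (forall d, (forall i, i \in active A b v -> slope d i = 0) -> d = 0) ->
  is_vertex P v.
Proof.
move=> Pv Hd; exists (\sum_(i in active A b v) (row i A)^T),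
  (\sum_(i in active A b v) b 0 i).
have E x : (x *m (\sum_(i in active A b v) (row i A)^T)) 0 0 +
    \sum_(i in active A b v) b 0 i = \sum_(i in active A b v) j x 0 i.
  rewrite mulmx_sumr summxE -big_split /=; apply: eq_bigr => i _.
  rewrite /j_map !mxE; congr (_ + _); apply: eq_bigr => s _.
  by rewrite !mxE.
split=> [x Px|]; first by rewrite E sumr_ge0 // => i _; exact: Px.
apply/seteqP; split=> [_ ->|x /= [Px]].
  by split=> //; rewrite E big1 // => i; rewrite mem_active => /eqP.
rewrite E => /eqP; rewrite psumr_eq0 => [/allP H|i _]; last exact: Px.
apply/eqP; rewrite -subr_eq0; apply/eqP/Hd => i iv.
have := H i (mem_index_enum _); rewrite iv /= => /eqP jx.
move: (iv); rewrite mem_active => /eqP jv.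
have := j_map_line v (x - v) 1 i.
by rewrite scale1r addrC subrK mul1r jx jv add0r.
Qed.

Lemma descent_direction d v : bounded_set P -> P v -> d != 0 ->
  exists i, slope d i < 0.
Proof.
move=> bP Pv d0; apply: contrapT => /forallNP Hn.
have Hge i : 0 <= slope d i by rewrite leNgt; apply/negP/Hn.
have [M [_ HM]] := bP.
have nd : 0 < `|d| by rewrite normr_gt0.
(* Far enough along [d] to leave the ball of radius [`|M| + 1]. *)
pose t := (`|M| + 1 + `|v| + 1) / `|d|.
have t0 : 0 <= t by rewrite divr_ge0 // !addr_ge0.
have Pt : P (v + t *: d).
  by move=> i; rewrite j_map_line addr_ge0 ?Pv // mulr_ge0.
have := HM (`|M| + 1) _ _ Pt; rewrite (le_lt_trans (ler_norm M)) ?ltrDl //.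
move=> /(_ isT) H.
have : `|t *: d| <= `|v + t *: d| + `|v|.
  by rewrite -{1}(addKr v (t *: d)) addrC (le_trans (ler_normD _ _)) // normrN.
by rewrite normrZ (ger0_norm t0) divfK ?gt_eqF //; move: H => /=; lra.
Qed.

(** Among the points lying on all the facets through [x0], one that lies on as many
    facets as possible is a vertex: a line staying in its facets would, by
    boundedness, run into one more facet. *)
Lemma exists_vertex_above x0 : bounded_set P -> P x0 ->
  exists v, [/\ P v, is_vertex P v & active A b x0 \subset active A b v].
Proof.
move=> bP Px0.
pose good (N : nat) := exists v, [/\ P v, active A b x0 \subset active A b v &
  #|active A b v| = N].
have ex : exists N, `[< good N >] by exists #|active A b x0|; apply/asboolP; exists x0.
have ub N : `[< good N >] -> (N <= m)%N.
  by move=> /asboolP[v [_ _ <-]]; rewrite -[X in (_ <= X)%N]card_ord max_card.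
case: (ex_maxnP ex ub) => N /asboolP[v [Pv sv cv]] Nmax.
exists v; split=> //; apply: vertex_of_span => // d Hd.
apply/eqP/negPn/negP => d0.
have [i0 Hi0] := descent_direction bP Pv d0.
(* The parameter at which the half-line from [v] along [d] meets the [i]-th hyperplane;
   the smallest one leads to a point of the polytope on a further facet. *)
pose F i := j v 0 i / - slope d i.
have := @arg_minP _ _ _ i0 (fun i => slope d i < 0) F Hi0.
set l := Order.arg_min _ _ _; case=> l' /= ld lmin.
have F0 : 0 <= F l' by rewrite divr_ge0 ?Pv // oppr_ge0 ltW.
have Pv' : P (v + F l' *: d).
  move=> i; rewrite j_map_line; have [di|di] := leP 0 (slope d i).
    by rewrite addr_ge0 ?Pv // mulr_ge0.
  have := lmin i di; rewrite {2}/F ler_pdivlMr ?oppr_gt0 //.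
  by rewrite mulrN -subr_ge0 opprK.
have sub : active A b v \subset active A b (v + F l' *: d).
  apply/fintype.subsetP => i iv; rewrite mem_active j_map_line Hd // mulr0 addr0.
  by rewrite -mem_active.
have : (N < #|active A b (v + F l' *: d)|)%N.
  rewrite -cv; apply: proper_card; apply/properP; split=> //; exists l'.
    rewrite mem_active j_map_line /F invrN mulrN mulNr divfK ?subrr //.
    by rewrite lt_eqF.
  by apply/negP => /Hd E; rewrite E ltxx in ld.
rewrite ltnNge => /negP; apply; apply: Nmax; apply/asboolP.
by exists (v + F l' *: d); split=> //; exact: fintype.subset_trans sv sub.
Qed.

Lemma exists_vertex_order x0 : simple_polytope A b -> P x0 ->
  exists v sigma, vertex_order A b v sigma /\
    active A b x0 \subset active A b v.
Proof.
move=> [bP _ _ _ HP] Px0; have [v [_ vv sv]] := exists_vertex_above bP Px0.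
have cv := HP v vv.
pose sigma (s : 'I_n) : 'I_m := enum_val (cast_ord (esym cv) s).
exists v, sigma; split=> //; split=> //.
  by move=> s t /enum_val_inj /cast_ord_inj.
apply/setP => i; apply/idP/imsetP => [iv|[s _ ->]]; last exact: enum_valP.
exists (cast_ord cv (enum_rank_in iv i)) => //.
by rewrite /sigma cast_ordK enum_rankK_in.
Qed.

Section VertexCoordinates.
Variables (v : 'rV[R]_n) (sigma : 'I_n -> 'I_m).
Lemma mul_rowsub d s : (d *m (rowsub sigma A)^T) 0 s = slope d (sigma s).
Proof. by rewrite !mxE; apply: eq_bigr => t _; rewrite !mxE. Qed.

Hypothesis v_sigma : vertex_order A b v sigma.

Lemma vertex_order_active s : sigma s \in active A b v.
Proof. by have [_ _ ->] := v_sigma; exact: imset_f. Qed.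

Lemma vertex_orderP i : i \in active A b v -> exists s, i = sigma s.
Proof. by have [_ _ ->] := v_sigma => /imsetP[s _ ->]; exists s. Qed.

(** The [n] normals of the facets through a vertex span, hence are independent, so the
    corresponding constraints are affine coordinates. *)
Lemma vertex_matrix_unit : (rowsub sigma A)^T \in unitmx.
Proof.
rewrite -row_free_unit; apply: inj_row_free => d Hd.
have [vv _ _] := v_sigma; apply: (vertex_normals_span vv) => i.
move=> /vertex_orderP[s ->].
by rewrite -mul_rowsub Hd mxE.
Qed.

(** The point of the affine space at which the constraints active at [v] take the
    values [q]. *)
Definition point_of (q : 'rV[R]_n) : 'rV[R]_n :=
  (q - \row_s b 0 (sigma s)) *m invmx (rowsub sigma A)^T.

Lemma j_map_point_of q s : j (point_of q) 0 (sigma s) = q 0 s.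
Proof.
rewrite /j_map mxE -mul_rowsub /point_of mulmxKV ?vertex_matrix_unit //.
by rewrite !mxE subrK.
Qed.

Lemma point_of_j_map x : point_of (\row_s j x 0 (sigma s)) = x.
Proof.
rewrite /point_of -[RHS](mulmxK vertex_matrix_unit); congr (_ *m _).
by apply/rowP => s; rewrite mul_rowsub /j_map !mxE addrK.
Qed.

Lemma C1_point_of (V : normedModType R) (F : V -> 'rV[R]_n) (x : V) :
  C1 F x -> C1 (point_of \o F) x.
Proof.
move=> FC; apply: C1_mulmxr.
by apply: (C1_add FC (G := cst (- \row_s b 0 (sigma s)))); exact: C1_cst.
Qed.

End VertexCoordinates.

(** Normals of the facets through a point are part of an affine coordinate system at
    some vertex, so one facet can be left while staying in the others. *)
Lemma edge_direction x0 k : simple_polytope A b -> P x0 -> j x0 0 k = 0 ->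
  exists w, slope w k = 1 /\
    forall l, j x0 0 l = 0 -> l != k -> slope w l = 0.
Proof.
move=> HP Px0 jk; have [v [sigma [vs sub]]] := exists_vertex_order HP Px0.
have act l : j x0 0 l = 0 -> exists s, l = sigma s.
  by move=> jl; apply: (vertex_orderP vs); apply: (fintype.subsetP sub); rewrite mem_active jl.
have [s ks] := act k jk.
exists (delta_mx 0 s *m invmx (rowsub sigma A)^T).
have U := vertex_matrix_unit vs.
split=> [|l jl]; first by rewrite ks -mul_rowsub mulmxKV // mxE !eqxx.
have [t ->] := act l jl; rewrite ks -mul_rowsub mulmxKV // mxE eqxx /=.
by have [->|] := eqVneq t s; rewrite ?eqxx.
Qed.

End PolytopeGeometry.

(** * Continuous arguments of circle-valued maps *)

Section ContinuousArgument.
Context {R : realType}.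

Lemma circle_argument (c s : R) : c ^+ 2 + s ^+ 2 = 1 ->
  exists t, cos t = c /\ sin t = s.
Proof.
move=> cs1.
have c1 : -1 <= c <= 1.
  by apply/andP; split; have := sqr_ge0 s; nra.
have sE : Num.sqrt (1 - c ^+ 2) = `|s| by rewrite -cs1 addrC addKr sqrtr_sqr.
have [s0|s0] := leP 0 s.
  exists (acos c); rewrite acosK ?in_itv // sin_acos // sE ger0_norm //.
exists (- acos c); rewrite cosN sinN acosK ?in_itv // sin_acos // sE.
by rewrite ltr0_norm // opprK.
Qed.

Lemma atan_ratio (C S : R) : 0 < C -> C ^+ 2 + S ^+ 2 = 1 ->
  cos (atan (S / C)) = C /\ sin (atan (S / C)) = S.
Proof.
move=> C0 CS1; have E : cos (atan (S / C)) = C.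
  rewrite cos_atan; have -> : 1 + (S / C) ^+ 2 = (C ^-1) ^+ 2.
    have S2 : S ^+ 2 = 1 - C ^+ 2 by rewrite -CS1 addrC addKr.
    by rewrite exprMn S2; field; rewrite gt_eqF.
  by rewrite sqrtr_sqr gtr0_norm ?invr_gt0 // invrK.
split=> //; have := atanK (S / C); rewrite /tan E => /(congr1 ( *%R^~ C)).
by rewrite !divfK // gt_eqF.
Qed.

Section Lift.
Variables (V : normedModType R) (X : set V) (c s : V -> R).
Hypotheses (X_compact : compact X)
  (X_convex : forall x y (t : R), X x -> X y -> 0 <= t <= 1 ->
     X (x + t *: (y - x)))
  (c_cont : forall x, X x -> c y @[y --> within X (nbhs x)] --> c x)
  (s_cont : forall x, X x -> s y @[y --> within X (nbhs x)] --> s x)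
  (cs1 : forall x, X x -> c x ^+ 2 + s x ^+ 2 = 1).

Local Notation cos_diff x y := (c x * c y + s x * s y).
Local Notation sin_diff x y := (c x * s y - s x * c y).

(** By compactness, the angle between the values at two close points is uniformly acute. *)
Lemma uniform_cos_diff : exists2 d, 0 < d &
  forall x y, X x -> X y -> `|x - y| < d -> 0 < cos_diff x y.
Proof.
have /compact_near_coveringP/near_covering_withinP H := X_compact.
have := H R (0 : R)^'+ (fun d x => forall y, X y -> `|x - y| < d -> 0 < cos_diff x y)
  _ _.
case.
- move=> x Xx.
  (* Two values that are both within 1/4 of the value at [x] in each coordinate differ
     by less than 1/2 in each coordinate, so the angle between them is acute. *)
  have /cvgrPdist_lt /(_ 4^-1) := c_cont Xx; have q0 : (0 : R) < 4^-1 by [].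
  move=> /(_ q0) cx; have /cvgrPdist_lt /(_ _ q0) sx := s_cont Xx.
  have : \forall y \near x, X y -> `|c x - c y| < 4^-1 /\ `|s x - s y| < 4^-1.
    move: cx sx; rewrite !near_withinE; apply: filterS2 => y cy sy Xy.
    by split; [exact: cy | exact: sy].
  move=> /nbhs_ballP[r /= r0 Hr].
  have r2 : 0 < r / 2 by rewrite divr_gt0.
  exists (ball x (r / 2), [set d | d < r / 2]) => /=.
    split; first exact: nbhsx_ballx.
    exact: nbhs_right_lt.
  move=> [x' d] /= [xx' dr] Xx' y Xy xy.
  have xy' : ball x r y.
    rewrite -ball_normE /= in xx' *.
    rewrite -(subrKA x') (le_lt_trans (ler_normD _ _)) // (splitr r) ltrD //.
    exact: lt_trans xy dr.
  have xr : ball x r x'.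
    by apply: le_ball xx'; rewrite ler_pdivrMr // ler_pMr // ler1n.
  have [c1 s1] := Hr _ xy' Xy; have [c2 s2] := Hr _ xr Xx'.
  have n1 := cs1 Xy; have n2 := cs1 Xx'.
  move: c1 s1 c2 s2; rewrite !ltr_norml => /andP[a1 a2] /andP[a3 a4].
  move=> /andP[a5 a6] /andP[a7 a8].
  nra.
- move=> d /= d0 Hd; exists (d / 2); first by rewrite divr_gt0.
  move=> x y Xx Xy xy; apply: (Hd (d / 2)) => //=.
    by rewrite sub0r normrN gtr0_norm ?divr_gt0 // ltr_pdivrMr // ltr_pMr // ltr1n.
  by rewrite divr_gt0.
Qed.

Variable x0 : V.
Hypothesis X_x0 : X x0.

Let p (N i : nat) x : V := x0 + (i%:R / N%:R) *: (x - x0).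

Let p_in N i x : (i <= N)%N -> (0 < N)%N -> X x -> X (p N i x).
Proof.
move=> iN N0 Xx; apply: X_convex => //.
by rewrite divr_ge0 //= ler_pdivrMr ?ltr0n // mul1r ler_nat.
Qed.

Let p_cont N i x : (i <= N)%N -> (0 < N)%N -> X x ->
  p N i y @[y --> within X (nbhs x)] --> within X (nbhs (p N i x)).
Proof.
move=> iN N0 Xx; have pc : {for x, continuous (p N i)}.
  apply: cvgD; first exact: cvg_cst.
  apply: cvgZ; first exact: cvg_cst.
  by apply: cvgB; [exact: cvg_id | exact: cvg_cst].
move=> U UX; have H : \forall y \near x, X (p N i y) -> U (p N i y) := pc _ UX.
change (\forall y \near x, X y -> U (p N i y)).
apply: filterS H => y Hy Xy; apply: Hy.
exact: p_in.
Qed.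

Let step N i x : R :=
  atan (sin_diff (p N i x) (p N i.+1 x) / cos_diff (p N i x) (p N i.+1 x)).

(** The argument is accumulated along the segment from [x0] to [x], which is cut in
    equally many pieces for all [x], so short that the angle varies by less than a
    right angle on each and is a continuous function of [x] through [atan]. *)
Lemma continuous_argument : exists th : V -> R, forall x, X x ->
  [/\ cos (th x) = c x, sin (th x) = s x &
      th y @[y --> within X (nbhs x)] --> th x].
Proof.
have [d d0 Hd] := uniform_cos_diff.
have [M [Mr HM]] := compact_bounded X_compact.
have [t0 [ct0 st0]] := circle_argument (cs1 X_x0).
pose B := `|M| + 1 + `|x0|.
have B0 : 0 < B by rewrite /B; have := normr_ge0 M; have := normr_ge0 x0; lra.
have XB x : X x -> `|x - x0| <= B.
  move=> Xx; rewrite (le_trans (ler_normB _ _)) // lerD2r.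
  by apply: HM => //; rewrite (le_lt_trans (ler_norm M)) // ltrDl.
(* [B] bounds the distance to [x0], so [N] pieces make every step shorter than [d]. *)
pose N := (Num.truncn (B / d)).+1.
have N0 : (0 < N)%N by [].
have BN : B / N%:R < d.
  rewrite ltr_pdivrMr ?ltr0n // mulrC -ltr_pdivrMr //.
  exact: truncnS_gt.
have cd0 i x : (i < N)%N -> X x -> 0 < cos_diff (p N i x) (p N i.+1 x).
  move=> iN Xx; apply: Hd; [exact: p_in (ltnW iN) _ _|exact: p_in|].
  rewrite /p opprD addrACA subrr add0r -scalerBl normrZ -mulrBl.
  rewrite -natr1 opprD addNKr mulN1r normrN.
  rewrite gtr0_norm ?invr_gt0 ?ltr0n //.
  apply: le_lt_trans BN; rewrite mulrC ler_wpM2r ?invr_ge0 //.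
  exact: XB.
exists (fun x => t0 + \sum_(i < N) step N i x) => x Xx.
have angle k : (k <= N)%N ->
    cos (t0 + \sum_(i < k) step N i x) = c (p N k x) /\
    sin (t0 + \sum_(i < k) step N i x) = s (p N k x).
  elim: k => [_|k IH kN].
    by rewrite big_ord0 addr0 /p mul0r scale0r addr0.
  have [ck sk] := IH (ltnW kN).
  have n1 := cs1 (p_in (ltnW kN) N0 Xx); have n2 := cs1 (p_in kN N0 Xx).
  have [|cE sE] := atan_ratio (S := sin_diff (p N k x) (p N k.+1 x)) (cd0 k x kN Xx).
    transitivity ((c (p N k x) ^+ 2 + s (p N k x) ^+ 2) *
      (c (p N k.+1 x) ^+ 2 + s (p N k.+1 x) ^+ 2)); first by ring.
    by rewrite n1 n2 mulr1.
  rewrite big_ord_recr /= addrA /step; split.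
    rewrite cosD ck sk cE sE.
    transitivity ((c (p N k x) ^+ 2 + s (p N k x) ^+ 2) * c (p N k.+1 x)); first by ring.
    by rewrite n1 mul1r.
  rewrite sinD ck sk cE sE.
  transitivity ((c (p N k x) ^+ 2 + s (p N k x) ^+ 2) * s (p N k.+1 x)); first by ring.
  by rewrite n1 mul1r.
have [] := angle N (leqnn N).
have -> : p N N x = x.
  by rewrite /p divff ?pnatr_eq0 // scale1r addrC subrK.
split=> //; apply: cvgD; first exact: cvg_cst.
apply: (cvg_big (op := +%R)) => [|i _]; first exact: add_continuous.
have iN := ltn_ord i.
have cc k : (k <= N)%N -> c (p N k y) @[y --> within X (nbhs x)] --> c (p N k x).
  by move=> kN; apply: cvg_comp (p_cont kN N0 Xx) (c_cont (p_in kN N0 Xx)).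
have sc k : (k <= N)%N -> s (p N k y) @[y --> within X (nbhs x)] --> s (p N k x).
  by move=> kN; apply: cvg_comp (p_cont kN N0 Xx) (s_cont (p_in kN N0 Xx)).
apply: (@cvg_comp _ _ _ _ (@atan R)); last exact: continuous_atan.
apply: cvgM; last (apply: cvgV; first by rewrite gt_eqF // cd0).
- apply: cvgB; apply: cvgM; [exact: cc (ltnW iN)|exact: sc|exact: sc (ltnW iN)|exact: cc].
- apply: cvgD; apply: cvgM; [exact: cc (ltnW iN)|exact: cc|exact: sc (ltnW iN)|exact: sc].
Qed.

End Lift.
End ContinuousArgument.

(** * The real moment-angle manifold *)

Section MomentAngle.
Context {R : realType}.
Variables (m n : nat).
Implicit Types (A : 'M[R]_(m, n)) (b : 'rV[R]_m) (u r e : 'rV[R]_m)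
  (z t : 'rV[R[i]]_m) (k : 'I_m).

Local Notation cplx u := (map_mx (real_complex R) u).

Lemma normc_unit (t : R[i]) : `|t| = 1 -> Normc.normc t = 1.
Proof.
rewrite normc_def => /eqP; rewrite eq_complex /= => /andP[/eqP H _].
by case: t H.
Qed.

Lemma normc_real (x : R) : Normc.normc (real_complex R x) = `|x|.
Proof. by rewrite /= expr0n /= addr0 sqrtr_sqr. Qed.

Lemma normc_sqr (z : R[i]) :
  Normc.normc z = Num.sqrt (complex.Re z ^+ 2 + complex.Im z ^+ 2).
Proof. by case: z. Qed.

Lemma moment_angleP A b z : moment_angle A b z <->
  exists2 x, polytope A b x & forall k, Normc.normc (z 0 k) ^+ 2 = j_map A b x 0 k.
Proof.
split=> [[x Px E]|[x Px E]]; exists x => //.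
  by move=> k; rewrite E mxE.
by apply/rowP => k; rewrite -E [RHS]mxE.
Qed.

Lemma real_moment_angleP A b u : real_moment_angle A b u <->
  exists2 x, polytope A b x & forall k, u 0 k ^+ 2 = j_map A b x 0 k.
Proof.
rewrite /real_moment_angle /=; split=> [/moment_angleP[x Px E]|[x Px E]].
  by exists x => // k; rewrite -E mxE normc_real real_normK ?num_real.
by apply/moment_angleP; exists x => // k; rewrite mxE normc_real real_normK ?num_real.
Qed.

Lemma s_imageP A b r : s_image A b r <->
  real_moment_angle A b r /\ forall k, 0 <= r 0 k.
Proof.
split=> [[x Px <-]|[/real_moment_angleP[x Px E] r0]].
  split=> [|k]; last by rewrite mxE sqrtr_ge0.
  by apply/real_moment_angleP; exists x => // k; rewrite mxE sqr_sqrtr.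
by exists x => //; apply/rowP => k; rewrite mxE -E sqrtr_sqr ger0_norm.
Qed.

Lemma moment_angle_torus A b t z : (forall k, `|t 0 k| = 1) ->
  moment_angle A b z -> moment_angle A b (coord_mul t z).
Proof.
move=> t1 /moment_angleP[x Px E]; apply/moment_angleP; exists x => // k.
by rewrite mxE Normc.normcM normc_unit // mul1r.
Qed.

Definition signs e := forall k, e 0 k = 1 \/ e 0 k = -1.

Lemma cplx_signs e : signs e -> forall k, `|(cplx e) 0 k| = 1.
Proof.
move=> He k; rewrite mxE normc_def /= expr0n /= addr0 sqrtr_sqr.
by case: (He k) => ->; rewrite ?normrN normr1.
Qed.

Lemma cplx_coord_mul e u : cplx (coord_mul e u) = coord_mul (cplx e) (cplx u).
Proof. by apply/rowP => k; rewrite !mxE rmorphM. Qed.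

Lemma real_moment_angle_signs A b e u : signs e ->
  real_moment_angle A b u -> real_moment_angle A b (coord_mul e u).
Proof.
move=> He; rewrite /real_moment_angle /= cplx_coord_mul.
by apply: moment_angle_torus; exact: cplx_signs.
Qed.

Definition flip k : 'rV[R]_m := \row_j (if j == k then -1 else 1).

Lemma flip_signs k : signs (flip k).
Proof. by move=> i; rewrite mxE; case: ifP; [right | left]. Qed.

Lemma flip_fix k u : u 0 k = 0 -> coord_mul (flip k) u = u.
Proof.
by move=> uk; apply/rowP => i; rewrite !mxE; case: eqVneq => [->|_]; rewrite ?uk ?mulr0 ?mul1r.
Qed.

Lemma is_diff_coord_mul e u : is_diff u (coord_mul e) (coord_mul e).
Proof.
apply: is_diff_row => i.
have H := is_diff_comp (@is_diff_coord _ _ _ u 0 i) (is_diff_scaler (e 0 i) _).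
have E : (fun y : 'rV[R]_m => coord_mul e y 0 i) = *:%R (e 0 i) \o (fun y : 'rV[R]_m => y 0 i).
  by apply/funext => y; rewrite mxE.
by rewrite E.
Qed.

Lemma realifyK z : complexify (realify z) = z.
Proof. by apply/rowP => k; rewrite !mxE; case: (z 0 k). Qed.

Lemma complexifyK p : realify (@complexify R m p) = p.
Proof.
by case: p => p1 p2; rewrite /realify /complexify; congr pair; apply/rowP => k; rewrite !mxE.
Qed.

Lemma realify_cplx u : realify (cplx u) = (u, 0).
Proof. by congr pair; apply/rowP => k; rewrite !mxE. Qed.

(** The curve lies over the path [x + s ^+ 2 *: w], where [w] leaves the [k]-th facet
    and stays in the others: its [k]-th coordinate is [s] itself, and the others are
    functions of [s ^+ 2], hence stationary at [0]. *)
Lemma crossing_curve A b u k : simple_polytope A b -> real_moment_angle A b u ->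
  u 0 k = 0 -> exists gam : R -> 'rV[R]_m,
  [/\ gam 0 = u, is_diff 0 gam (fun s : R => s *: delta_mx 0 k),
      \forall s \near (0 : R), real_moment_angle A b (gam s),
      forall s, gam (- s) = coord_mul (flip k) (gam s) &
      forall s, gam s 0 k = s].
Proof.
move=> HP /real_moment_angleP[x Px uE] uk.
have [|w [wk wl]] := edge_direction (k := k) HP Px; first by rewrite -uE uk expr0n.
pose sl i := (w *m A^T) 0 i.
(* The sign keeps the curve on the sheet of [u]. *)
pose gam s : 'rV[R]_m :=
  \row_i (if i == k then s else Num.sg (u 0 i) * Num.sqrt (u 0 i ^+ 2 + s ^+ 2 * sl i)).
have jE s i : j_map A b (x + s ^+ 2 *: w) 0 i = u 0 i ^+ 2 + s ^+ 2 * sl i.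
  by rewrite j_map_line -uE.
have sl0 i : i != k -> u 0 i = 0 -> sl i = 0.
  by move=> ik ui; apply: wl => //; rewrite -uE ui expr0n.
exists gam; split.
- apply/rowP => i; rewrite mxE; case: eqVneq => [->//|_].
  by rewrite expr0n /= mul0r addr0 sqrtr_sqr mulr_sg_norm.
- apply: is_diff_row => i.
  have Hi : is_diff (0 : R) (fun s => s) (fun s => s) by exact: is_diff_id.
  have [->|ik] := eqVneq i k.
    have -> : (fun y => gam y 0 k) = id by apply/funext => s; rewrite mxE eqxx.
    have -> : (fun s : R => (s *: (delta_mx 0 k : 'rV[R]_m)) 0 k) = id.
      by apply/funext => s; rewrite !mxE !eqxx mulr1.
    exact: is_diff_id.
  have -> : (fun s : R => (s *: (delta_mx 0 k : 'rV[R]_m)) 0 i) = 0.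
    by apply/funext => s; rewrite !mxE eqxx (negbTE ik) mulr0.
  have [ui|ui] := eqVneq (u 0 i) 0.
    have -> : (fun y => gam y 0 i) = cst 0.
      by apply/funext => s; rewrite mxE (negbTE ik) ui sgr0 mul0r.
    exact: is_diff_cst.
  have u2 : 0 < u 0 i ^+ 2 by rewrite exprn_even_gt0.
  have H2 := is_diffM Hi Hi.
  have H3 := is_diffD (is_diff_cst (u 0 i ^+ 2) (0 : R))
    (is_diff_comp H2 (is_diff_scaler (sl i) _)).
  have H4 := is_diff_comp H3 (is_diff_sqrt _).
  have H5 := is_diff_comp (H4 _) (is_diff_scaler (Num.sg (u 0 i)) _).
  have E : (fun y => gam y 0 i) = *:%R (Num.sg (u 0 i)) \o
     (@Num.sqrt R \o (cst (u 0 i ^+ 2) + ( *:%R (sl i) \o ((fun s : R => s) * (fun s : R => s))))).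
    by apply/funext => s; rewrite mxE (negbTE ik) /= !fctE /GRing.scale /= [sl i * _]mulrC -expr2.
  rewrite E; apply: is_diff_eq (H5 _) _.
    by rewrite !fctE /= /GRing.scale /= !mulr0 addr0.
  apply/funext => s; rewrite !fctE /GRing.scale /=.
  by rewrite !mul0r !addr0 !mulr0 [X in X / _]add0r mul0r mulr0.
- have H i : \forall s \near (0 : R), 0 <= u 0 i ^+ 2 + s ^+ 2 * sl i.
    have [->|ik] := eqVneq i k.
      have Hall (s : R) : 0 <= u 0 k ^+ 2 + s ^+ 2 * sl k.
        by rewrite uk expr0n /= add0r /sl wk mulr1 sqr_ge0.
      exact: (near_everywhere _ Hall).
    have [ui|ui] := eqVneq (u 0 i) 0.
      have Hall (s : R) : 0 <= u 0 i ^+ 2 + s ^+ 2 * sl i.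
        by rewrite sl0 // ui expr0n /= add0r mulr0.
      exact: (near_everywhere _ Hall).
    have u2 : 0 < u 0 i ^+ 2 by rewrite exprn_even_gt0.
    have c1 : {for (0 : R), continuous (fun s : R => u 0 i ^+ 2 + s ^+ 2 * sl i)}.
      apply: for_continuousD; first exact: for_continuous_cst.
      apply: for_continuousM; last exact: for_continuous_cst.
      by apply: for_continuousM; exact: for_continuous_id.
    have := near_gt (a := 0) c1; rewrite expr0n /= mul0r addr0 => /(_ u2).
    by apply: filterS => s; exact: ltW.
  apply: filterS (near_forall H) => s Hs; apply/real_moment_angleP.
  exists (x + s ^+ 2 *: w) => [i|i]; first by rewrite jE.
  rewrite jE mxE; case: eqVneq => [->|ik].
    by rewrite uk expr0n /= add0r /sl wk mulr1.
  rewrite exprMn sqr_sqrtr // sqr_sg; have [ui|ui] := eqVneq (u 0 i) 0.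
    by rewrite sl0 // ui mul0r expr0n /= mulr0 addr0.
  by rewrite mul1r.
- by move=> s; apply/rowP => i; rewrite !mxE; case: ifP => _; rewrite ?mulN1r ?mul1r ?sqrrN.
- by move=> s; rewrite mxE eqxx.
Qed.

End MomentAngle.

(** * Equivariant diffeomorphisms and coordinate hyperplanes *)

Section EquivariantDiffeo.
Context {R : realType}.
Variables (m n : nat).

Local Notation cplx u := (map_mx (real_complex R) u).
Local Notation pairs := ('rV[R]_m * 'rV[R]_m)%type.

Definition smooth_on (X : set 'rV[R[i]]_m) (f : 'rV[R[i]]_m -> 'rV[R[i]]_m) :=
  Cr_map None (@realify R m @` X) (@realify R m \o f \o @complexify R m).

(** The inverse is part of the data so that every result applies to it by symmetry. *)
Record torus_iso (X Y : set 'rV[R[i]]_m) (f h : 'rV[R[i]]_m -> 'rV[R[i]]_m) : Prop :=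
  TorusIso {
    iso_fwd : forall z, X z -> Y (f z) /\ h (f z) = z;
    iso_bwd : forall z, Y z -> X (h z) /\ f (h z) = z;
    iso_smooth : smooth_on X f;
    iso_inv_smooth : smooth_on Y h;
    iso_equiv : torus_equivariant X f;
    iso_inv_equiv : torus_equivariant Y h }.

Lemma torus_iso_sym X Y f h : torus_iso X Y f h -> torus_iso Y X h f.
Proof. by case=> *; split. Qed.

Lemma torus_iso_of_diffeo (A A' : 'M[R]_(m, n)) (b b' : 'rV[R]_m) f :
  complex_Cr_diffeo None (moment_angle A b) (moment_angle A' b') f ->
  torus_equivariant (moment_angle A b) f ->
  exists h, torus_iso (moment_angle A b) (moment_angle A' b') f h.
Proof.
move=> [h0 [fwd bwd fs hs]] feq; pose h := @complexify R m \o h0 \o @realify R m.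
have hE : @realify R m \o h \o @complexify R m = h0.
  by apply/funext => p; rewrite /h /= !complexifyK.
have Hfwd z : moment_angle A b z -> moment_angle A' b' (f z) /\ h (f z) = z.
  move=> Xz; have [|[w Yw wE] hz] := fwd (realify z); first by exists z.
  move: wE hz; rewrite /= !realifyK => wE hz; rewrite /h /= hz realifyK.
  by rewrite -[f z]realifyK -wE realifyK.
have Hbwd z : moment_angle A' b' z -> moment_angle A b (h z) /\ f (h z) = z.
  move=> Xz; have [|[w Yw wE] hz] := bwd (realify z); first by exists z.
  rewrite /h /=; move: hz; rewrite /= -wE realifyK => hz; split=> //.
  by rewrite -[f w]realifyK hz realifyK.
exists h; split=> //; first by rewrite /smooth_on hE.
move=> t z t1 Yz; have [Xw wE] := Hbwd z Yz.
have Xtw := moment_angle_torus t1 Xw.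
by rewrite -{1}wE -feq //; have [_] := Hfwd _ Xtw.
Qed.

Lemma is_diff_fst_coord i (q : pairs) :
  is_diff q (fun q : pairs => q.1 0 i) (fun q => q.1 0 i).
Proof.
have H : is_diff q (@fst 'rV[R]_m 'rV[R]_m) fst.
  by apply: (is_diff_linear (L := fst)) => p; exact: cvg_fst.
have H' := is_diff_comp H (@is_diff_coord _ _ _ _ 0 i).
exact: H'.
Qed.

Lemma is_diff_snd_coord i (q : pairs) :
  is_diff q (fun q : pairs => q.2 0 i) (fun q => q.2 0 i).
Proof.
have H : is_diff q (@snd 'rV[R]_m 'rV[R]_m) snd.
  by apply: (is_diff_linear (L := snd)) => p; exact: cvg_snd.
have H' := is_diff_comp H (@is_diff_coord _ _ _ _ 0 i).
exact: H'.
Qed.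

Section LocalForm.
Variables (A A' : 'M[R]_(m, n)) (b b' : 'rV[R]_m)
  (f h : 'rV[R[i]]_m -> 'rV[R[i]]_m).
Hypotheses (HP : simple_polytope A b)
  (fh : torus_iso (moment_angle A b) (moment_angle A' b') f h).
Local Notation RZ := (real_moment_angle A b).
Implicit Types (u e : 'rV[R]_m) (k : 'I_m).

Lemma smooth_on_real (A1 : 'M[R]_(m, n)) b1 f1 u :
  smooth_on (moment_angle A1 b1) f1 ->
  real_moment_angle A1 b1 u -> exists F : 'rV[R]_m -> pairs,
  C1 F u /\ \forall v \near u, real_moment_angle A1 b1 v -> F v = realify (f1 (cplx v)).
Proof.
move=> sm Xu; have [|U [F [oU Uu FC FE]]] := sm (u, 0).
  by exists (cplx u) => //; rewrite realify_cplx.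
pose L v : pairs := (v, 0).
have HL v : is_diff v L L.
  have H := is_diff_pair (is_diff_id v) (is_diff_cst (0 : 'rV[R]_m) v).
  exact: H.
have FC1 : C1 F (u, 0) by apply: (C1_open F oU).1 => //; exact: (FC 1%N).
exists (F \o L); split; first exact: C1_comp_linearr.
have Lc : {for u, continuous L}.
  by apply: differentiable_continuous; have [] := HL u.
have := Lc _ (open_nbhs_nbhs (conj oU Uu)).
rewrite nbhs_simpl /=; apply: filterS => v Uv Xv /=.
have <- : realify (cplx v) = L v by rewrite realify_cplx.
rewrite FE /= ?realifyK //; first by exists (cplx v).
by rewrite realify_cplx.
Qed.

Lemma equivariant_signs e u : signs e -> RZ u ->
  f (cplx (coord_mul e u)) = coord_mul (cplx e) (f (cplx u)).
Proof.
move=> He Xu; rewrite cplx_coord_mul (iso_equiv fh) //.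
exact: cplx_signs.
Qed.

Lemma equivariant_signsE e u k : signs e -> RZ u ->
  f (cplx (coord_mul e u)) 0 k = real_complex R (e 0 k) * f (cplx u) 0 k.
Proof. by move=> He Xu; rewrite equivariant_signs // !mxE. Qed.

(** A point with vanishing [k]-th coordinate is fixed by the corresponding sign change,
    hence so is its image; the converse uses injectivity of [f]. *)
Lemma equivariant_eq0 u k : RZ u -> (f (cplx u) 0 k == 0) = (u 0 k == 0).
Proof.
move=> Xu; apply/eqP/eqP => [fk|uk]; last first.
  have := equivariant_signsE k (flip_signs k) Xu.
  rewrite flip_fix // mxE eqxx rmorphN rmorph1 mulN1r => /eqP.
  by rewrite -subr_eq0 opprK -mulr2n -mulr_natr mulf_eq0 pnatr_eq0 orbF => /eqP.
have E : f (cplx (coord_mul (flip k) u)) = f (cplx u).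
  rewrite equivariant_signs //; last exact: flip_signs.
  apply/rowP => i; rewrite !mxE; case: eqVneq => [->|_]; first by rewrite fk mulr0.
  by rewrite rmorph1 mul1r.
have Xe := real_moment_angle_signs (flip_signs k) Xu.
have [_ E1] := iso_fwd fh Xu; have [_ E2] := iso_fwd fh Xe.
have := congr1 (fun z : 'rV[R[i]]_m => complex.Re (z 0 k))
  (etrans (esym E2) (etrans (congr1 h E) E1)).
by rewrite !mxE /= eqxx; lra.
Qed.

(** The crossing curve has velocity [e_k] at [u]. Its image has vanishing velocity in
    every coordinate other than the [k]-th, by parity, and nonzero velocity, because
    the inverse map sends it back to the crossing curve. *)
Lemma normal_derivative_neq0 u k (F : 'rV[R]_m -> pairs) : RZ u -> u 0 k = 0 ->
  C1 F u -> (\forall v \near u, RZ v -> F v = realify (f (cplx v))) ->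
  ('d F u (delta_mx 0 k)).1 0 k != 0 \/ ('d F u (delta_mx 0 k)).2 0 k != 0.
Proof.
move=> Xu uk FC FE.
have [gam [g0 gd gX gflip gk]] := crossing_curve HP Xu uk.
have gc : {for (0 : R), continuous gam}.
  by apply: differentiable_continuous; have [] := gd.
have Xfu : moment_angle A' b' (f (cplx u)) by have [] := iso_fwd fh Xu.
have [|V [G [oV Vu GC GE]]] := iso_inv_smooth fh (x := realify (f (cplx u))).
  by exists (f (cplx u)).
have Fu : F u = realify (f (cplx u)) by apply: (nbhs_singleton FE).
have Fd : is_diff u F ('d F u) by apply: differentiableP; exact: C1_differentiable.
have FEg : \forall s \near (0 : R), RZ (gam s) /\ F (gam s) = realify (f (cplx (gam s))).
  rewrite -g0 in FE; have H := gc _ FE; rewrite nbhs_simpl /= in H.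
  by apply: filterS2 gX H => s Xs; split=> //; auto.
have Fgd : is_diff (0 : R) (F \o gam) ('d F u \o (fun s : R => s *: delta_mx 0 k)).
  by apply: is_diff_comp; rewrite g0.
have Fgc : {for (0 : R), continuous (F \o gam)}.
  by apply: differentiable_continuous; have [] := Fgd.
have GC1 : C1 G (F u).
  by rewrite Fu; apply: (C1_open G oV).1 => //; exact: (GC 1%N).
have Gd : is_diff (F u) G ('d G (F u)) by apply: differentiableP; exact: C1_differentiable.
pose L (v : 'rV[R]_m) : pairs := (v, 0).
have HL v : is_diff v L L.
  have H := is_diff_pair (is_diff_id v) (is_diff_cst (0 : 'rV[R]_m) v).
  exact: H.
have GFE : \forall s \near (0 : R), (G \o (F \o gam)) s = (L \o gam) s.
  have VFu : nbhs ((F \o gam) 0) V.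
    by rewrite /= g0 Fu; exact: open_nbhs_nbhs.
  have H := Fgc _ VFu; rewrite nbhs_simpl /= in H.
  apply: filterS2 H FEg => s Vs [Xs E]; rewrite /= E GE /= ?realifyK -?E //; last first.
    by rewrite E; exists (f (cplx (gam s))) => //; have [] := iso_fwd fh Xs.
  by have [_ ->] := iso_fwd fh Xs; rewrite realify_cplx.
have D1 : is_diff (0 : R) (L \o gam) (L \o (fun s : R => s *: delta_mx 0 k)).
  exact: is_diff_comp.
have D2 : is_diff (0 : R) (G \o (F \o gam))
    ('d G (F u) \o ('d F u \o (fun s : R => s *: delta_mx 0 k))).
  by apply: is_diff_comp; rewrite /= g0.
(* Differentiating [h (f (gam s)) = gam s] at [0]. *)
have Ed : 'd G (F u) ('d F u (delta_mx 0 k)) = L (delta_mx 0 k).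
  have [_ E1] := is_diff_near_eq GFE D1; have [_ E2] := D2.
  have := congr1 (fun d => d (1 : R)) (etrans (esym E2) E1).
  by rewrite /= scale1r.
(* The coordinates other than the [k]-th are even along the curve. *)
have other i : i != k -> ('d F u (delta_mx 0 k)).1 0 i = 0 /\
    ('d F u (delta_mx 0 k)).2 0 i = 0.
  move=> ik.
  have ev : \forall s \near (0 : R), (F (gam (- s))).1 0 i = (F (gam s)).1 0 i /\
      (F (gam (- s))).2 0 i = (F (gam s)).2 0 i.
    have FEg' : \forall s \near (0 : R), RZ (gam (- s)) /\
        F (gam (- s)) = realify (f (cplx (gam (- s)))).
      have Nc : {for (0 : R), continuous (fun s : R => - s)}.
        by apply: cvgN; exact: cvg_id.
      rewrite -[X in \forall s \near X, _]oppr0 in FEg.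
      by have H := Nc _ FEg; rewrite nbhs_simpl /= in H.
    apply: filterS2 FEg FEg' => s [Xs E] [_ E']; rewrite E E' gflip.
    rewrite equivariant_signs //; last exact: flip_signs.
    by rewrite !mxE (negbTE ik) rmorph1 mul1r.
  have D3 := is_diff_comp Fgd.
  split.
  - have := even_diff0 (D3 _ _ _ (is_diff_fst_coord i _)); rewrite /= scale1r; apply.
    by apply: filterS ev => s [].
  - have := even_diff0 (D3 _ _ _ (is_diff_snd_coord i _)); rewrite /= scale1r; apply.
    by apply: filterS ev => s [].
apply: contrapT => /not_orP[/negP/negPn/eqP d1 /negP/negPn/eqP d2].
have d0 : 'd F u (delta_mx 0 k) = 0.
  rewrite [LHS]surjective_pairing; congr pair; apply/rowP => i; rewrite mxE.
    by have [->|/other[]] := eqVneq i k.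
  by have [->|/other[]] := eqVneq i k.
move: Ed; rewrite d0 linear0 => /(congr1 (fun q : pairs => q.1 0 k)).
by rewrite /= !mxE !eqxx => /eqP; rewrite eq_sym oner_eq0.
Qed.

End LocalForm.
End EquivariantDiffeo.

(** * The signed modulus is of class C^1 *)

Section Factorization.
Context {R : realType}.
Variables (m n : nat).

Local Notation cplx u := (map_mx (real_complex R) u).

(** The data of a local factorization [fk = v_k (Q1 + i Q2)] at [u]: the numerators
    [phi1] and [phi2] extend the real and imaginary parts of [fk] to the ambient space. *)
Record local_factor (X : set 'rV[R]_m) (fk : 'rV[R]_m -> R[i]) (k : 'I_m)
    (u : 'rV[R]_m) (phi1 phi2 Q1 Q2 : 'rV[R]_m -> R) : Prop := LocalFactor {
  factor_C1 : C1 phi1 u /\ C1 phi2 u;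
  factor_E : \forall v \near u, phi1 v = (v : 'rV[R]_m) 0 k * Q1 v /\
                                phi2 v = (v : 'rV[R]_m) 0 k * Q2 v;
  factor_cont : \forall v \near u, {for v, continuous Q1} /\ {for v, continuous Q2};
  factor_pos : 0 < Q1 u ^+ 2 + Q2 u ^+ 2;
  factor_val : \forall v \near u, X v -> fk v = Complex (phi1 v) (phi2 v) }.

Section LocalForm.
Variables (A A' : 'M[R]_(m, n)) (b b' : 'rV[R]_m)
  (f h : 'rV[R[i]]_m -> 'rV[R[i]]_m).
Hypotheses (HP : simple_polytope A b)
  (fh : torus_iso (moment_angle A b) (moment_angle A' b') f h).
Local Notation RZ := (real_moment_angle A b).
Implicit Types (u e : 'rV[R]_m) (k : 'I_m).

Lemma sum_sqr_gt0 (x y : R) : x != 0 \/ y != 0 -> 0 < x ^+ 2 + y ^+ 2.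
Proof.
case=> H.
  by rewrite ltr_wpDr ?sqr_ge0 // exprn_even_gt0.
by rewrite ltr_wpDl ?sqr_ge0 // exprn_even_gt0.
Qed.

(** The extension of an odd function of [u_k] has no reason to be odd; its odd part is,
    and it has the same normal derivative on the hyperplane. *)
Lemma odd_part_C1 (F : 'rV[R]_m -> R) k u : u 0 k = 0 -> C1 F u ->
  let phi v := 2^-1 * (F v - F (coord_mul (flip k) v)) in
  C1 phi u /\ 'd phi u (delta_mx 0 k) = 'd F u (delta_mx 0 k).
Proof.
move=> uk FC phi; have rho := @is_diff_coord_mul R m (flip k).
have fu : coord_mul (flip k) u = u by exact: flip_fix.
have FrC : C1 (F \o coord_mul (flip k)) u.
  by apply: C1_comp_linearr => //; rewrite fu.
split.
  have H := C1_scale (2^-1) (C1_sub FC FrC).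
  exact: H.
have Fd : is_diff u F ('d F u) by apply: differentiableP; exact: C1_differentiable.
have D : is_diff u (F \o coord_mul (flip k)) ('d F u \o coord_mul (flip k)).
  have Fd' := Fd; rewrite -[X in is_diff X]fu in Fd'.
  exact: is_diff_comp (rho u) Fd'.
have D3 : is_diff u phi
    (fun v => 2^-1 * ('d F u v - 'd F u (coord_mul (flip k) v))).
  have H := is_diffZ (2^-1) (is_diffB Fd D).
  exact: H.
have [_ ->] := D3.
have dk : coord_mul (flip k) (delta_mx 0 k) = - delta_mx 0 k :> 'rV[R]_m.
  by apply/rowP => i; rewrite !mxE eqxx /=; case: eqVneq => _; rewrite ?mulr0 ?oppr0 ?mulN1r.
rewrite dk linearN opprK.
by move: ('d F u _) => x; field.
Qed.

(** Off the hyperplane one divides by the coordinate. On it, the odd part of an extension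
    vanishes on the hyperplane, and its quotient at [u] is the normal derivative. *)
Lemma local_factorization u k : RZ u -> exists phi1 phi2 Q1 Q2,
  local_factor RZ (fun v => f (cplx v) 0 k) k u phi1 phi2 Q1 Q2.
Proof.
move=> Xu; have [F [FC FE]] := smooth_on_real (iso_smooth fh) Xu.
pose F1 v : R := (F v).1 0 k; pose F2 v : R := (F v).2 0 k.
have F1C : C1 F1 u := C1_comp_linearl (is_diff_fst_coord k) FC.
have F2C : C1 F2 u := C1_comp_linearl (is_diff_snd_coord k) FC.
have F12E : \forall v \near u, RZ v -> f (cplx v) 0 k = Complex (F1 v) (F2 v).
  apply: filterS FE => v Hv /Hv E; rewrite /F1 /F2 E !mxE.
  by case: (f (cplx v) 0 k).
have [uk|uk] := eqVneq (u 0 k) 0; last first.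
  have nz : \forall v \near u, (v : 'rV[R]_m) 0 k != 0.
    exact: near_neq0 (@coord_continuous _ _ _ 0 k u) uk.
  exists F1, F2, (fun v => F1 v / v 0 k), (fun v => F2 v / v 0 k); split.
  - by split.
  - by apply: filterS nz => v vk; rewrite mulrC divfK // mulrC divfK.
  - have F12C : \forall v \near u, C1 F1 v /\ C1 F2 v.
      by apply: filterS2 (C1_near F1C) (C1_near F2C) => v c1 c2; split.
    apply: filterS2 nz F12C => v vk [c1 c2].
    by split; apply: for_continuousM; [exact: C1_continuous| |exact: C1_continuous|];
      apply: for_continuousV => //; exact: coord_continuous.
  - have := equivariant_eq0 fh k Xu; rewrite (negbTE uk).
    rewrite (nbhs_singleton F12E Xu) eq_complex /= => /negbT; rewrite negb_and => nf.
    apply: sum_sqr_gt0.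
    by case/orP: nf => nf; [left|right]; rewrite mulf_neq0 ?invr_eq0.
  - exact: F12E.
pose rho (v : 'rV[R]_m) := coord_mul (flip k) v.
pose odd_part (G : 'rV[R]_m -> R) v := 2^-1 * (G v - G (rho v)).
pose phi1 := odd_part F1; pose phi2 := odd_part F2.
have [phi1C phi1d] := odd_part_C1 uk F1C.
have [phi2C phi2d] := odd_part_C1 uk F2C.
have van (G : 'rV[R]_m -> R) (v : 'rV[R]_m) : v 0 k = 0 -> odd_part G v = 0.
  by move=> vk; rewrite /odd_part /rho flip_fix // subrr mulr0.
have nvan (G : 'rV[R]_m -> R) u' : \forall v \near u',
    (v : 'rV[R]_m) 0 k = 0 -> odd_part G v = 0.
  exact: (near_everywhere _ (@van G)).
exists phi1, phi2, (coord_quotient k phi1), (coord_quotient k phi2); split.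
- by split; [exact: phi1C | exact: phi2C].
- have Hall (v : 'rV[R]_m) : phi1 v = v 0 k * coord_quotient k phi1 v /\
      phi2 v = v 0 k * coord_quotient k phi2 v.
    by split; apply: coord_quotientE => vk; apply: van.
  exact: (near_everywhere _ Hall).
- apply: filterS2 (C1_near phi1C) (C1_near phi2C) => v c1 c2.
  by split; apply: coord_quotient_continuous; [exact: c1|exact: nvan|exact: c2|exact: nvan].
- have E1 : coord_quotient k phi1 u = 'd F1 u (delta_mx 0 k).
    by rewrite /coord_quotient uk eqxx; exact: phi1d.
  have E2 : coord_quotient k phi2 u = 'd F2 u (delta_mx 0 k).
    by rewrite /coord_quotient uk eqxx; exact: phi2d.
  rewrite E1 E2; apply: sum_sqr_gt0.
  have [D1 D2] : 'd F1 u (delta_mx 0 k) = ('d F u (delta_mx 0 k)).1 0 k /\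
      'd F2 u (delta_mx 0 k) = ('d F u (delta_mx 0 k)).2 0 k.
    have Fd : is_diff u F ('d F u) by apply: differentiableP; exact: C1_differentiable.
    have [_ E3] := is_diff_comp Fd (is_diff_fst_coord k _).
    have [_ E4] := is_diff_comp Fd (is_diff_snd_coord k _).
    split; [exact: (congr1 (fun d => d _) E3) | exact: (congr1 (fun d => d _) E4)].
  rewrite D1 D2; exact: (normal_derivative_neq0 HP fh Xu uk FC FE).
- have rc : {for u, continuous rho}.
    apply: differentiable_continuous.
    by have [] := @is_diff_coord_mul R m (flip k) u.
  have F12E' : \forall v \near u, RZ (rho v) ->
      f (cplx (rho v)) 0 k = Complex (F1 (rho v)) (F2 (rho v)).
    have H : nbhs (rho u) (fun w => RZ w -> f (cplx w) 0 k = Complex (F1 w) (F2 w)).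
      by rewrite /rho flip_fix.
    by have := rc _ H; rewrite nbhs_simpl.
  apply: filterS2 F12E F12E' => v E E' Xv.
  have := E' (real_moment_angle_signs (flip_signs k) Xv).
  rewrite (equivariant_signsE fh _ (flip_signs k)) // mxE eqxx rmorphN rmorph1 mulN1r (E Xv).
  move=> [e1 e2]; rewrite /phi1 /phi2 /odd_part -e1 -e2.
  by congr Complex; field.
Qed.

Definition modulus_map (r : 'rV[R]_m) : 'rV[R]_m :=
  \row_k Normc.normc (f (cplx r) 0 k).

Lemma norm_signs u : exists2 e, signs e & map_mx Num.norm u = coord_mul e u.
Proof.
exists (\row_i (if 0 <= u 0 i then 1 else -1)).
  by move=> i; rewrite mxE; case: ifP; [left | right].
apply/rowP => i; rewrite !mxE; case: leP => ui; first by rewrite mul1r ger0_norm.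
by rewrite mulN1r ltr0_norm.
Qed.

Lemma modulus_map_norm u k : RZ u ->
  modulus_map (map_mx Num.norm u) 0 k = Normc.normc (f (cplx u) 0 k).
Proof.
move=> Xu; have [e He ->] := norm_signs u.
rewrite mxE (equivariant_signsE fh) // Normc.normcM normc_real.
by case: (He k) => ->; rewrite ?normrN normr1 mul1r.
Qed.

Lemma sign_extension_modulusE u k : RZ u ->
  sign_extension modulus_map u 0 k = Num.sg (u 0 k) * Normc.normc (f (cplx u) 0 k).
Proof. by move=> Xu; rewrite mxE modulus_map_norm. Qed.

Lemma sign_extension_factor u k phi1 phi2 Q1 Q2 :
  local_factor RZ (fun v => f (cplx v) 0 k) k u phi1 phi2 Q1 Q2 ->
  \forall v \near u, RZ v -> sign_extension modulus_map v 0 k =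
     (v : 'rV[R]_m) 0 k * Num.sqrt (Q1 v ^+ 2 + Q2 v ^+ 2).
Proof.
case=> _ E _ _ V; apply: filterS2 E V => v [e1 e2] fv Xv.
rewrite sign_extension_modulusE // (fv Xv) normc_sqr /= e1 e2.
rewrite !exprMn -mulrDr sqrtrM ?sqr_ge0 // sqrtr_sqr mulrA mulr_sg_norm //.
Qed.

Lemma sign_extension_C1 u : RZ u -> exists K : 'rV[R]_m -> 'rV[R]_m,
  C1 K u /\ \forall v \near u, RZ v -> K v = sign_extension modulus_map v.
Proof.
move=> Xu.
have /choice[K HK] : forall k, exists K : 'rV[R]_m -> R, C1 K u /\
    \forall v \near u, RZ v -> K v = sign_extension modulus_map v 0 k.
  move=> k; have [p1 [p2 [q1 [q2 H]]]] := local_factorization k Xu.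
  exists (fun v : 'rV[R]_m => v 0 k * Num.sqrt (q1 v ^+ 2 + q2 v ^+ 2)); split.
    by have [[c1 c2] e c p _] := H; exact: C1_signed_norm c1 c2 e c p.
  by apply: filterS (sign_extension_factor H) => v Hv /Hv ->.
exists (fun v => \row_k K k v); split.
  apply: C1_row => k; have [H _] := HK k.
  by have -> : (fun v => (\row_k0 K k0 v) 0 k) = K k by apply/funext => v; rewrite mxE.
have H k : \forall v \near u, RZ v -> K k v = sign_extension modulus_map v 0 k.
  by have [] := HK k.
apply: filterS (near_forall H) => v Hv Xv; apply/rowP => k.
by rewrite mxE Hv.
Qed.

Lemma sign_extension_Cr : Cr_map (Some 1%N) RZ (sign_extension modulus_map).
Proof.
move=> u Xu; have [K [KC KE]] := sign_extension_C1 Xu.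
have : \forall v \near u, C1 K v /\ (RZ v -> K v = sign_extension modulus_map v).
  by apply: filterS2 (C1_near KC) KE => v c e; split.
move=> /near_open[U [oU Uu HU]]; exists U, K; split=> //.
  by apply/(C1_open _ oU) => v /HU[].
by move=> v Xv /HU[_]; apply.
Qed.

Lemma sign_extension_signs e u : signs e -> RZ u ->
  sign_extension modulus_map (coord_mul e u) =
  coord_mul e (sign_extension modulus_map u).
Proof.
move=> He Xu; have Xe := real_moment_angle_signs He Xu.
apply/rowP => k; rewrite [RHS]mxE !sign_extension_modulusE //.
rewrite (equivariant_signsE fh) // Normc.normcM normc_real mxE sgrM.
by case: (He k) => ->; rewrite ?normrN normr1 ?sgrN sgr1 ?mulN1r !mul1r ?mulN1r ?mulNr.
Qed.

(** Both sides have the same moduli coordinatewise, and vanish in the same coordinates. *)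
Lemma sign_extension_torus u : RZ u -> exists2 t : 'rV[R[i]]_m,
  (forall k, `|t 0 k| = 1) &
  cplx (sign_extension modulus_map u) = coord_mul t (f (cplx u)).
Proof.
move=> Xu; pose z := f (cplx u).
exists (\row_k (if z 0 k == 0 then 1 else
   real_complex R (Num.sg (u 0 k) * Normc.normc (z 0 k)) / z 0 k)).
  move=> k; rewrite mxE; case: eqVneq => [_|zk]; first by rewrite normr1.
  have uk : u 0 k != 0 by rewrite -(equivariant_eq0 fh).
  rewrite normrM normfV normc_def /= expr0n /= addr0 sqrtr_sqr normrM.
  rewrite normr_sg uk mul1r ger0_norm; last by rewrite normc_sqr sqrtr_ge0.
  rewrite normc_def -normc_sqr divff // fmorph_eq0.
  by apply: contraNneq zk => /Normc.eq0_normc ->.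
apply/rowP => k; rewrite [LHS]mxE sign_extension_modulusE // -/z [RHS]mxE.
rewrite [X in _ = X * _]mxE; case: eqVneq => [->|zk].
  by rewrite Normc.normc0 mulr0 rmorph0 mul1r.
by rewrite divfK.
Qed.

Lemma sign_extension_stable u : RZ u ->
  real_moment_angle A' b' (sign_extension modulus_map u).
Proof.
move=> Xu; have [t t1 E] := sign_extension_torus Xu.
rewrite /real_moment_angle /= E; apply: moment_angle_torus => //.
by have [] := iso_fwd fh Xu.
Qed.

End LocalForm.

(** The signed modulus differs from [f] by an element of the torus, with which the
    inverse of [f] commutes; hence the composition has the moduli of [u], and each
    signed modulus preserves signs. *)
Lemma sign_extension_cancel (A A' : 'M[R]_(m, n)) (b b' : 'rV[R]_m) f h u :
  torus_iso (moment_angle A b) (moment_angle A' b') f h ->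
  real_moment_angle A b u ->
  sign_extension (modulus_map h) (sign_extension (modulus_map f) u) = u.
Proof.
move=> fh Xu; have hf := torus_iso_sym fh.
have Xf := sign_extension_stable fh Xu.
have [t t1 E] := sign_extension_torus fh Xu.
have [Yf hfu] := iso_fwd fh Xu.
apply/rowP => k; rewrite (sign_extension_modulusE hf) // E.
rewrite (iso_equiv hf) // [coord_mul _ _ 0 k]mxE Normc.normcM normc_unit //.
rewrite mul1r hfu [map_mx _ u 0 k]mxE normc_real.
rewrite (sign_extension_modulusE fh) // sgrM sgr_id.
have [->|uk] := eqVneq (u 0 k) 0; first by rewrite sgr0 !mul0r.
rewrite [Num.sg (Normc.normc _)]gtr0_sg ?mulr1 ?mulr_sg_norm //.
rewrite lt_neqAle normc_sqr sqrtr_ge0 andbT eq_sym -normc_sqr.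
by apply: contraNneq uk => /Normc.eq0_normc/eqP; rewrite (equivariant_eq0 fh).
Qed.

End Factorization.

(** * The phase *)

Section Phase.
Context {R : realType}.
Variables (m n : nat) (A A' : 'M[R]_(m, n)) (b b' : 'rV[R]_m)
  (f h : 'rV[R[i]]_m -> 'rV[R[i]]_m).
Hypotheses (HP : simple_polytope A b)
  (fh : torus_iso (moment_angle A b) (moment_angle A' b') f h).
Local Notation cplx u := (map_mx (real_complex R) u).
Local Notation RZ := (real_moment_angle A b).
Implicit Types (u r q : 'rV[R]_m).

Lemma closed_polytope : closed (polytope A b).
Proof.
rewrite -openC openE => x /existsNP[i /negP]; rewrite -ltNge => jx.
have := near_lt (@j_map_continuous _ _ _ A b x i) jx.
by apply: filterS => y jy Py; have := Py i; rewrite leNgt jy.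
Qed.

Lemma j_image_compact : compact (j_map A b @` polytope A b).
Proof.
apply: continuous_compact; last first.
  by apply: bounded_closed_compact; [have [] := HP | exact: closed_polytope].
apply: continuous_subspaceT => x; apply: C1_continuous; exact: C1_j_map.
Qed.

Lemma j_image_convex p q (t : R) : (j_map A b @` polytope A b) p ->
  (j_map A b @` polytope A b) q -> 0 <= t <= 1 ->
  (j_map A b @` polytope A b) (p + t *: (q - p)).
Proof.
move=> [x Px <-] [y Py <-] /andP[t0 t1]; exists (x + t *: (y - x)).
  move=> i; have -> : j_map A b (x + t *: (y - x)) 0 i =
      (1 - t) * j_map A b x 0 i + t * j_map A b y 0 i.
    have := j_map_line A b x (y - x) 1 i; rewrite scale1r addrC subrK mul1r => E.
    by rewrite j_map_line E; ring.
  by rewrite addr_ge0 // mulr_ge0 ?Px ?Py // subr_ge0.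
apply/rowP => i; rewrite j_map_line.
have := j_map_line A b x (y - x) 1 i; rewrite scale1r addrC subrK mul1r => E.
have gen (p1 q1 : 'rV[R]_m) : (p1 + t *: (q1 - p1)) 0 i = p1 0 i + t * (q1 0 i - p1 0 i).
  by rewrite !mxE.
by rewrite gen E [_ + _ - _]addrAC subrr add0r.
Qed.

Lemma sqrt_row_continuous q :
  {for q, continuous (fun p : 'rV[R]_m => \row_i Num.sqrt (p 0 i) : 'rV[R]_m)}.
Proof.
move=> U [V HV HU]; rewrite nbhs_simpl /=.
have H i : \forall p \near q, V 0 i (Num.sqrt ((p : 'rV[R]_m) 0 i)).
  have c : {for q, continuous (fun p : 'rV[R]_m => Num.sqrt (p 0 i))}.
    by apply: for_continuous_sqrt; exact: coord_continuous.
  have := HV 0 i; rewrite mxE; exact: c.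
apply: filterS (near_forall H) => p Hp; apply: HU => j i.
by rewrite mxE ord1; exact: Hp.
Qed.

Lemma sqr_row_continuous q :
  {for q, continuous (fun p : 'rV[R]_m => \row_i (p 0 i ^+ 2) : 'rV[R]_m)}.
Proof.
move=> U [V HV HU]; rewrite nbhs_simpl /=.
have H i : \forall p \near q, V 0 i ((p : 'rV[R]_m) 0 i ^+ 2).
  have c : {for q, continuous (fun p : 'rV[R]_m => p 0 i ^+ 2)}.
    by apply: for_continuousM; exact: coord_continuous.
  have := HV 0 i; rewrite mxE; exact: c.
apply: filterS (near_forall H) => p Hp; apply: HU => j i.
by rewrite mxE ord1; exact: Hp.
Qed.

(** Where [u_k] is nonzero the quotient is determined by division; at the other points,
    by continuity along the crossing curve. *)
Lemma local_factor_unique u k phi1 phi2 Q1 Q2 :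
  local_factor RZ (fun v => f (cplx v) 0 k) k u phi1 phi2 Q1 Q2 ->
  \forall v \near u, RZ v -> forall psi1 psi2 S1 S2,
    local_factor RZ (fun v => f (cplx v) 0 k) k (v : 'rV[R]_m) psi1 psi2 S1 S2 ->
    S1 v = Q1 v /\ S2 v = Q2 v.
Proof.
case=> _ /near_join qE /near_join qc _ /near_join qv.
apply: filterS3 qE qc qv => {}v qE qc qv Xv psi1 psi2 S1 S2 [_ sE sc _ sv].
have E : \forall w \near v, RZ w -> (w : 'rV[R]_m) 0 k * S1 w = w 0 k * Q1 w /\
    w 0 k * S2 w = w 0 k * Q2 w.
  have E1 : \forall w \near v, RZ w -> psi1 w = phi1 w /\ psi2 w = phi2 w.
    by apply: filterS2 qv sv => w e1 e2 Xw; have := e1 Xw; rewrite e2 // => -[].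
  apply: filterS3 E1 qE sE => w e1 [e2 e3] [e4 e5] Xw.
  by have [e6 e7] := e1 Xw; rewrite -e4 -e5 -e2 -e3 e6 e7.
have [vk|vk] := eqVneq (v 0 k) 0; last first.
  by have [e1 e2] := nbhs_singleton E Xv; split; apply: (mulfI vk).
have [gam [g0 gd gX _ gk]] := crossing_curve HP Xv vk.
have gc : {for (0 : R), continuous gam}.
  by apply: differentiable_continuous; have [] := gd.
have [q1 q2] := nbhs_singleton qc; have [s1 s2] := nbhs_singleton sc.
rewrite -g0 in E q1 q2 s1 s2 *.
have Eg : \forall t \near (0 : R), t != 0 -> S1 (gam t) = Q1 (gam t) /\
    S2 (gam t) = Q2 (gam t).
  have H := gc _ E; rewrite nbhs_simpl /= in H.
  apply: filterS2 H gX => t Ht Xt t0; have [] := Ht Xt.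
  by rewrite !gk => e1 e2; split; apply: (mulfI t0).
split.
- apply: (@eq_of_punctured R (S1 \o gam) (Q1 \o gam)).
  + exact: (continuous_comp (f := gam) (g := S1) gc s1).
  + exact: (continuous_comp (f := gam) (g := Q1) gc q1).
  by apply: filterS Eg => t Ht /Ht[].
- apply: (@eq_of_punctured R (S2 \o gam) (Q2 \o gam)).
  + exact: (continuous_comp (f := gam) (g := S2) gc s2).
  + exact: (continuous_comp (f := gam) (g := Q2) gc q2).
  by apply: filterS Eg => t Ht /Ht[].
Qed.

(** The local quotients agree wherever they are defined, so their values at the centres
    of the factorizations form a continuous function. *)
Lemma coordinate_quotient k : exists q1 q2 : 'rV[R]_m -> R, forall u, RZ u ->
  [/\ f (cplx u) 0 k = Complex (u 0 k * q1 u) (u 0 k * q2 u),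
      0 < q1 u ^+ 2 + q2 u ^+ 2,
      q1 v @[v --> within RZ (nbhs u)] --> q1 u &
      q2 v @[v --> within RZ (nbhs u)] --> q2 u].
Proof.
have /choice[Q HQ] : forall u, exists Q : ('rV[R]_m -> R) * ('rV[R]_m -> R), RZ u ->
    exists phi1 phi2, local_factor RZ (fun v => f (cplx v) 0 k) k u phi1 phi2 Q.1 Q.2.
  move=> u; have [Xu|nXu] := pselect (RZ u); last by exists (cst 0, cst 0).
  have [p1 [p2 [q1 [q2 H]]]] := local_factorization HP fh k Xu.
  by exists (q1, q2) => _; exists p1, p2.
exists (fun u => (Q u).1 u), (fun u => (Q u).2 u) => u Xu.
have [p1 [p2 F]] := HQ u Xu.
have U : \forall v \near u, RZ v -> (Q v).1 v = (Q u).1 v /\ (Q v).2 v = (Q u).2 v.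
  have H := local_factor_unique F.
  apply: filterS H => v Hv Xv.
  by have [r1 [r2 G]] := HQ v Xv; have := Hv Xv _ _ _ _ G.
have [_ E c pos V] := F; have [c1 c2] := nbhs_singleton c.
split=> //.
- by rewrite (nbhs_singleton V Xu); have [-> ->] := nbhs_singleton E.
- by apply: within_near_eq Xu c1 _; apply: filterS U => v Hv /Hv[].
- by apply: within_near_eq Xu c2 _; apply: filterS U => v Hv /Hv[].
Qed.

Lemma sqrt_j_image q : (j_map A b @` polytope A b) q ->
  s_image A b (\row_i Num.sqrt (q 0 i)).
Proof. by move=> [x Px <-]; exists x. Qed.

Lemma sqr_s_image r : s_image A b r ->
  (j_map A b @` polytope A b) (\row_i (r 0 i ^+ 2)).
Proof.
move=> [x Px <-]; exists x => //; apply/rowP => i.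
by rewrite [RHS]mxE [s_map _ _ _ 0 i]mxE sqr_sqrtr.
Qed.

(** The squares of the coordinates range over a convex compact set, on which the unit
    vector [(q1, q2) / |(q1, q2)|] has a continuous argument. *)
Lemma continuous_phase k : exists th : 'rV[R]_m -> R, forall r, s_image A b r ->
  f (cplx r) 0 k = expi (th r) * real_complex R (modulus_map f r 0 k) /\
  th v @[v --> within (s_image A b) (nbhs r)] --> th r.
Proof.
have [q1 [q2 Hq]] := coordinate_quotient k.
pose N u := Num.sqrt (q1 u ^+ 2 + q2 u ^+ 2).
have N0 u : RZ u -> 0 < N u by move=> /Hq[_ p _ _]; rewrite sqrtr_gt0.
have Nc u : RZ u -> N v @[v --> within RZ (nbhs u)] --> N u.
  move=> Xu; have [_ _ c1 c2] := Hq u Xu.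
  apply: (@cvg_comp _ _ _ _ (@Num.sqrt R)); last exact: sqrt_continuous.
  by apply: cvgD; apply: cvgM.
pose c u := q1 u / N u; pose s u := q2 u / N u.
have cc u : RZ u -> c v @[v --> within RZ (nbhs u)] --> c u.
  move=> Xu; have [_ _ c1 _] := Hq u Xu; apply: cvgM => //.
  by apply: cvgV; [rewrite gt_eqF // N0 | exact: Nc].
have sc u : RZ u -> s v @[v --> within RZ (nbhs u)] --> s u.
  move=> Xu; have [_ _ _ c2] := Hq u Xu; apply: cvgM => //.
  by apply: cvgV; [rewrite gt_eqF // N0 | exact: Nc].
have cs u : RZ u -> c u ^+ 2 + s u ^+ 2 = 1.
  move=> Xu; rewrite /c /s !exprMn -mulrDl exprVn sqr_sqrtr ?divff //.
    by rewrite gt_eqF //; have [] := Hq u Xu.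
  by rewrite ltW //; have [] := Hq u Xu.
pose root q : 'rV[R]_m := \row_i Num.sqrt (q 0 i).
pose X := j_map A b @` polytope A b.
have XR q : X q -> RZ (root q) by move=> /sqrt_j_image/s_imageP[].
have [x Px] : exists x, polytope A b x.
  by have [_ [[x [_ [Px _ _]]] _] _ _ _] := HP; exists x.
have Xx : X (j_map A b x) by exists x.
have [th Hth] := @continuous_argument R _ X (c \o root) (s \o root)
  j_image_compact j_image_convex
  (fun q Xq => cvg_within_comp (@sqrt_row_continuous q) XR (cc _ (XR q Xq)))
  (fun q Xq => cvg_within_comp (@sqrt_row_continuous q) XR (sc _ (XR q Xq)))
  (fun q Xq => cs _ (XR q Xq)) _ Xx.
exists (fun r => th (\row_i (r 0 i ^+ 2))) => r Sr.
have [Xr r0] := (s_imageP A b r).1 Sr; have X2 := sqr_s_image Sr.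
have rootK : root (\row_i (r 0 i ^+ 2)) = r.
  by apply/rowP => i; rewrite !mxE sqrtr_sqr ger0_norm.
have [cE sE tc] := Hth _ X2; rewrite /= rootK in cE sE.
split; last first.
  apply: (@cvg_within_comp _ _ _ _ X (fun r => \row_i (r 0 i ^+ 2))) => //.
    exact: sqr_row_continuous.
  exact: sqr_s_image.
have [fE _ _ _] := Hq r Xr.
have ME : modulus_map f r 0 k = r 0 k * N r.
  rewrite mxE fE normc_sqr /= !exprMn -mulrDr sqrtrM ?sqr_ge0 // sqrtr_sqr.
  by rewrite ger0_norm.
have nN : N r != 0 by rewrite gt_eqF // N0.
rewrite ME fE /expi cE sE; apply/eqP; rewrite eq_complex /= !mulr0 subr0 add0r.
by apply/andP; split; apply/eqP; rewrite /c /s mulrCA divfK // mulrC.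
Qed.

End Phase.

(** * Vertex charts *)

Section VertexChart.
Context {R : realType}.
Variables (m n : nat) (A : 'M[R]_(m, n)) (b : 'rV[R]_m).
Variables (v : 'rV[R]_n) (sigma : 'I_n -> 'I_m).
Hypothesis v_sigma : vertex_order A b v sigma.
Local Notation RZ := (real_moment_angle A b).
Local Notation c := (vertex_chart A b v sigma).
Implicit Types (y : 'rV[R]_n) (r : 'rV[R]_m).

(** Chart coordinates are square roots of the active constraints, so the latter take the
    values [y 0 s ^+ 2]. *)
Definition sqr_point y : 'rV[R]_n := point_of A b sigma (\row_s (y 0 s ^+ 2)).

Definition chart_domain : set 'rV[R]_n :=
  [set y | forall l, l \notin active A b v -> 0 < j_map A b (sqr_point y) 0 l].

(** The inverse of the vertex chart, extended to negative values of the coordinates;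
    the extension takes its values in the real moment-angle manifold. *)
Definition chart_param y : 'rV[R]_m :=
  \row_k (if [pick s | sigma s == k] is Some s then y 0 s
          else Num.sqrt (j_map A b (sqr_point y) 0 k)).

Lemma chart_param_active y s : chart_param y 0 (sigma s) = y 0 s.
Proof.
have [_ si _] := v_sigma; rewrite mxE; case: pickP => [s' /eqP/si -> //|/(_ s)].
by rewrite eqxx.
Qed.

Lemma pick_inactive l : l \notin active A b v -> [pick s | sigma s == l] = None.
Proof.
case: pickP => // s /eqP <- /negP[]; exact: (vertex_order_active v_sigma).
Qed.

Lemma chart_param_inactive y l : l \notin active A b v ->
  chart_param y 0 l = Num.sqrt (j_map A b (sqr_point y) 0 l).
Proof. by move=> lv; rewrite mxE pick_inactive. Qed.

Lemma j_map_sqr_point y s : j_map A b (sqr_point y) 0 (sigma s) = y 0 s ^+ 2.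
Proof. by rewrite (j_map_point_of v_sigma) mxE. Qed.

Lemma chart_param_real y : chart_domain y -> RZ (chart_param y).
Proof.
move=> Uy; apply/real_moment_angleP; exists (sqr_point y) => k;
  have [/(vertex_orderP v_sigma)[s ->]|kv] := boolP (k \in active A b v).
- by rewrite j_map_sqr_point sqr_ge0.
- exact/ltW/Uy.
- by rewrite chart_param_active j_map_sqr_point.
- by rewrite chart_param_inactive // sqr_sqrtr // ltW // Uy.
Qed.

Lemma sqr_point_C1 y : C1 sqr_point y.
Proof.
apply: (@C1_point_of _ _ _ A b sigma _ (fun y : 'rV[R]_n => \row_s (y 0 s ^+ 2) : 'rV[R]_n)).
apply: C1_row => s.
have -> : (fun y : 'rV[R]_n => (\row_s0 (y 0 s0 ^+ 2) : 'rV[R]_n) 0 s) =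
    (fun x : R => x ^+ 2) \o (fun y : 'rV[R]_n => y 0 s).
  by apply/funext => z; rewrite mxE.
apply: C1_compR; first by apply: C1_coord; exact: C1_id.
apply: (@C1_intro _ _ _ _ (fun x w : R => (2 * x) * w)).
have Hall (x : R) : is_diff x (fun x : R => x ^+ 2) (fun w => 2 * x * w) /\
    forall w, {for x, continuous (fun z : R => 2 * z * w)}.
  split; last first.
    move=> w; apply: for_continuousM; last exact: for_continuous_cst.
    apply: for_continuousM; [exact: for_continuous_cst|exact: for_continuous_id].
  have H := @is_diffX R _ _ _ 1 x (is_diff_id x).
  apply: is_diff_eq H _; apply/funext => w.
  by rewrite !fctE /GRing.scale /= expr1.
exact: (near_everywhere _ Hall).
Qed.

Lemma j_sqr_point_C1 y l : C1 (fun y => j_map A b (sqr_point y) 0 l) y.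
Proof.
apply: C1_coord; have H := C1_comp (@sqr_point_C1 y) (@C1_j_map _ _ _ A b _).
exact: H.
Qed.

Lemma chart_domain_near y : chart_domain y -> \forall z \near y, chart_domain z.
Proof.
move=> Uy; apply: near_forall => l.
have [lv|lv] := boolP (l \in active A b v).
  have Hall (z : 'rV[R]_n) : ~~ true -> 0 < j_map A b (sqr_point z) 0 l by [].
  exact: (near_everywhere _ Hall).
have H := near_gt (C1_continuous (j_sqr_point_C1 y l)) (Uy l lv).
by apply: filterS H => z.
Qed.

Lemma chart_param_C1 y : chart_domain y -> C1 chart_param y.
Proof.
move=> Uy; apply: C1_row => k.
have [/(vertex_orderP v_sigma)[s ->]|kv] := boolP (k \in active A b v).
  have -> : (fun y => chart_param y 0 (sigma s)) = (fun y => y 0 s).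
    by apply/funext => z; rewrite chart_param_active.
  by apply: C1_coord; exact: C1_id.
have -> : (fun y => chart_param y 0 k) =
    @Num.sqrt R \o (fun y => j_map A b (sqr_point y) 0 k).
  by apply/funext => z; rewrite chart_param_inactive.
apply: C1_compR; first exact: j_sqr_point_C1.
by apply: C1_sqrt; exact: Uy.
Qed.

Lemma chart_param_coord r : RZ r ->
  (forall l, l \notin active A b v -> 0 < r 0 l) ->
  chart_domain (chart_coord c r) /\ chart_param (chart_coord c r) = r.
Proof.
move=> /real_moment_angleP[x Px E] r0.
have xE : sqr_point (chart_coord c r) = x.
  rewrite -[RHS](point_of_j_map v_sigma) /sqr_point; congr point_of.
  by apply/rowP => s; rewrite [LHS]mxE [RHS]mxE -E mxE.
split=> [l lv /=|]; first by rewrite xE -E exprn_gt0 // r0.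
apply/rowP => k.
have [/(vertex_orderP v_sigma)[s ->]|kv] := boolP (k \in active A b v).
  by rewrite chart_param_active mxE.
by rewrite chart_param_inactive // xE -E sqrtr_sqr gtr0_norm // r0.
Qed.

Lemma chart_domP r : chart_dom c r <->
  s_image A b r /\ forall l, l \notin active A b v -> r 0 l != 0.
Proof.
split=> [[x [Px nx] <-]|[[x Px <-] r0]].
  split=> [|l lv]; first by exists x.
  rewrite mxE; apply/negP => /eqP j0; apply: nx; exists l => //; split=> //.
  by apply/eqP; rewrite eq_le Px andbT -sqrtr_eq0 j0.
exists x => //; split=> // -[l lv [_ jl]].
by have := r0 l lv; rewrite mxE jl sqrtr0 eqxx.
Qed.

Lemma chart_dom_param r : chart_dom c r ->
  chart_domain (chart_coord c r) /\ chart_param (chart_coord c r) = r.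
Proof.
move=> /chart_domP[/s_imageP[Xr r0] rl]; apply: chart_param_coord => // l lv.
by rewrite lt_neqAle r0 eq_sym rl.
Qed.

Lemma chart_param_dom y : chart_domain y -> orthant y ->
  [/\ s_image A b (chart_param y), chart_dom c (chart_param y) &
      chart_coord c (chart_param y) = y].
Proof.
move=> Uy y0; have I : s_image A b (chart_param y).
  apply/s_imageP; split=> [|k]; first exact: chart_param_real.
  have [/(vertex_orderP v_sigma)[s ->]|kv] := boolP (k \in active A b v).
    by rewrite chart_param_active y0.
  by rewrite chart_param_inactive // sqrtr_ge0.
split=> //.
  apply/chart_domP; split=> // l lv.
  by rewrite chart_param_inactive // gt_eqF // sqrtr_gt0 Uy.
by apply/rowP => s; rewrite mxE chart_param_active.
Qed.

Lemma chart_dom_coord r : chart_dom c r ->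
  chart_domain (chart_coord c r) /\ orthant (chart_coord c r).
Proof.
move=> dr; have [Ur _] := chart_dom_param dr; split=> // s.
by have /chart_domP[/s_imageP[_ r0] _] := dr; rewrite mxE.
Qed.

Lemma chart_invE y : chart_domain y -> orthant y -> chart_inv c y = chart_param y.
Proof.
move=> Uy y0; have [_ dy cy] := chart_param_dom Uy y0.
have : exists r, [set r | chart_dom c r /\ chart_coord c r = y] r.
  by exists (chart_param y).
move=> /getPex; rewrite -/(chart_inv c y); set r := chart_inv c y.
by move=> [dr cr]; have [_ <-] := chart_dom_param dr; rewrite cr.
Qed.

End VertexChart.

(** * The modulus between the polytopes *)

Section Diffeo.
Context {R : realType}.
Variables (m n : nat) (A A' : 'M[R]_(m, n)) (b b' : 'rV[R]_m)
  (f h : 'rV[R[i]]_m -> 'rV[R[i]]_m).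
Hypotheses (HP : simple_polytope A b)
  (fh : torus_iso (moment_angle A b) (moment_angle A' b') f h).
Local Notation g := (modulus_map f).
Local Notation fhat := (sign_extension (modulus_map f)).
Implicit Types (r : 'rV[R]_m).

Lemma s_image_real r : s_image A b r -> real_moment_angle A b r.
Proof. by move=> /s_imageP[]. Qed.

Lemma modulus_map_eq0 r k : s_image A b r -> (g r 0 k == 0) = (r 0 k == 0).
Proof.
move=> /s_image_real Xr; rewrite -(equivariant_eq0 fh k Xr) mxE.
by apply/eqP/eqP => [/Normc.eq0_normc|->]; rewrite ?Normc.normc0.
Qed.

Lemma sign_extension_s_image r : s_image A b r -> fhat r = g r.
Proof.
move=> Sr; have [Xr r0] := (s_imageP A b r).1 Sr; apply/rowP => k.
rewrite (sign_extension_modulusE fh) // [RHS]mxE.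
have [rk|rk] := eqVneq (r 0 k) 0.
  have := modulus_map_eq0 k Sr; rewrite rk eqxx mxE => /eqP ->.
  by rewrite mulr0.
by rewrite gtr0_sg ?mul1r // lt_neqAle r0 eq_sym rk.
Qed.

Lemma modulus_map_s_image r : s_image A b r -> s_image A' b' (g r).
Proof.
move=> Sr; apply/s_imageP; split=> [|k]; last by rewrite mxE normc_sqr sqrtr_ge0.
rewrite -(sign_extension_s_image Sr); apply: (sign_extension_stable fh).
exact: s_image_real.
Qed.

Lemma modulus_map_continuous r k : s_image A b r ->
  g v 0 k @[v --> within (s_image A b) (nbhs r)] --> g r 0 k.
Proof.
move=> Sr; have [K [KC KE]] := sign_extension_C1 HP fh (s_image_real Sr).
apply: (@within_near_eq _ _ _ (fun v => g v 0 k) (fun v => K v 0 k)) => //.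
  by apply: C1_continuous; exact: C1_coord.
apply: filterS KE => v Hv Sv.
by rewrite Hv ?sign_extension_s_image //; exact: s_image_real.
Qed.

(** Chart domains are described by the nonvanishing of coordinates, which [g] preserves,
    so the domain of the coordinate expression is the orthant part of an open set; on
    that set the signed modulus in the extended coordinates is the ambient C^1
    extension. *)
Lemma modulus_map_corner_Cr v sigma v' sigma' :
  vertex_order A b v sigma -> vertex_order A' b' v' sigma' ->
  let c := vertex_chart A b v sigma in
  let c' := vertex_chart A' b' v' sigma' in
  corner_Cr (Some 1%N) (chart_coord c @` (chart_dom c `&` g @^-1` chart_dom c'))
      (fun y => chart_coord c' (g (chart_inv c y))).
Proof.
move=> vs vs' c c'; pose Phi := chart_param A b sigma.
pose U := [set y | chart_domain A b v sigma y /\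
  forall l, l \notin active A' b' v' -> Phi y 0 l != 0].
have Uopen : open U.
  rewrite openE => y [Uy Hy].
  have H l : \forall z \near y, l \notin active A' b' v' -> Phi z 0 l != 0.
    have [lv|lv] := boolP (l \in active A' b' v').
      have Hall (z : 'rV[R]_n) : ~~ true -> Phi z 0 l != 0 by [].
      exact: (near_everywhere _ Hall).
    have := near_neq0 (C1_continuous (C1_coord 0 l (chart_param_C1 vs Uy))) (Hy l lv).
    by apply: filterS => z.
  have : \forall z \near y, U z.
    have H2 : \forall z \near y, forall l, l \notin active A' b' v' -> Phi z 0 l != 0.
      exact: near_forall H.
    have H1 := chart_domain_near Uy.
    apply: filterS2 H1 H2 => z Uz Hz; split; [exact: Uz|exact: Hz].
  exact.
have WE : chart_coord c @` (chart_dom c `&` g @^-1` chart_dom c') = U `&` @orthant R n.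
  apply/seteqP; split=> [_ [r [dr gr] <-]|y [[Uy Hy] y0]].
    have [Ur r0] := chart_dom_coord vs dr; split=> //; split=> // l lv.
    have -> : Phi (chart_coord c r) = r by have [] := chart_dom_param vs dr.
    have [Sr _] := (chart_domP A b v sigma r).1 dr.
    by rewrite -(modulus_map_eq0 l Sr); have [_ ->] := (chart_domP A' b' v' sigma' _).1 gr.
  have [Sy dy cy] := chart_param_dom vs Uy y0.
  exists (Phi y) => //; split=> //; apply/chart_domP.
  split=> [|l lv]; first exact: modulus_map_s_image.
  by rewrite modulus_map_eq0 // Hy.
exists U, (fun y => \row_s fhat (Phi y) 0 (sigma' s)); split=> //.
- apply/(C1_open _ Uopen) => y [Uy Hy].
  have Xy := chart_param_real vs Uy.
  have [K [KC KE]] := sign_extension_C1 HP fh Xy.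
  have PhiC := chart_param_C1 vs Uy.
  have E : \forall z \near y, \row_s fhat (Phi z) 0 (sigma' s) =
      \row_s K (Phi z) 0 (sigma' s).
    have H := C1_continuous PhiC KE; rewrite nbhs_simpl /= in H.
    apply: filterS2 H (chart_domain_near Uy) => z Hz Uz.
    have Xz := chart_param_real vs Uz.
    by apply/rowP => s; rewrite [LHS]mxE [RHS]mxE (Hz Xz).
  apply: C1_near_eq E _; apply: C1_row => s.
  have -> : (fun z => (\row_s0 K (Phi z) 0 (sigma' s0) : 'rV[R]_n) 0 s) =
      (fun z => (K \o Phi) z 0 (sigma' s)).
    by apply/funext => z; rewrite mxE.
  by apply: C1_coord; exact: C1_comp.
- move=> y; rewrite WE => -[[Uy Hy] y0]; rewrite (chart_invE vs Uy y0).
  have [Sy _ _] := chart_param_dom vs Uy y0.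
  by rewrite -(sign_extension_s_image Sy).
Qed.

(** The one-sided limit is the derivative along the [t]-th axis of a differentiable
    function defined on both sides and even in that variable. *)
Lemma modulus_map_normal_derivative v sigma (s t : 'I_n) (y : 'rV[R]_n) :
  vertex_order A b v sigma ->
  let c := vertex_chart A b v sigma in
  let gtilde y := g (chart_inv c y) 0 (sigma s) in
  t != s -> (chart_coord c @` chart_dom c) y -> y 0 t = 0 ->
  h^-1 * (gtilde (y + h *: delta_mx 0 t) - gtilde y) @[h --> 0^'+] --> (0 : R).
Proof.
move=> vs c gtilde ts [r dr ry] yt; pose Phi := chart_param A b sigma.
have [Uy y0] := chart_dom_coord vs dr; rewrite ry in Uy y0.
pose ln (a : R) : 'rV[R]_n := y + a *: delta_mx 0 t.
have lnD : is_diff (0 : R) ln (fun a => a *: delta_mx 0 t) by exact: is_diff_line.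
have ln0 : ln 0 = y by rewrite /ln scale0r addr0.
have lnU : \forall a \near (0 : R), chart_domain A b v sigma (ln a).
  have lc : {for (0 : R), continuous ln}.
    by apply: differentiable_continuous; have [] := lnD.
  have H := chart_domain_near Uy; rewrite -ln0 in H.
  by have := lc _ H; rewrite nbhs_simpl.
pose p a := fhat (Phi (ln a)) 0 (sigma s).
have [K [KC KE]] := sign_extension_C1 HP fh (chart_param_real vs Uy).
have PhiC := chart_param_C1 vs Uy.
pose q z := K (Phi z) 0 (sigma s).
have qC : C1 q y by apply: C1_coord; exact: (C1_comp PhiC KC).
have qD : is_diff (0 : R) (q \o ln) ('d q y \o (fun a => a *: delta_mx 0 t)).
  have qy : is_diff (ln 0) q ('d q y).
    by rewrite ln0; apply: differentiableP; exact: C1_differentiable.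
  exact: is_diff_comp lnD qy.
have pq : \forall a \near (0 : R), p a = (q \o ln) a.
  have H := C1_continuous PhiC KE; rewrite nbhs_simpl /= -ln0 in H.
  have lc : {for (0 : R), continuous ln}.
    by apply: differentiable_continuous; have [] := lnD.
  have H' := lc _ H; rewrite nbhs_simpl /= in H'.
  apply: filterS2 H' lnU => a Ha Ua; rewrite /p /q /=.
  by have Xa := chart_param_real vs Ua; rewrite (Ha Xa).
have pD := is_diff_near_eq pq qD.
(* As [y_t = 0], reflecting the line is changing the sign of the coordinate [sigma t]. *)
have lnN a : Phi (ln (- a)) = coord_mul (flip (sigma t)) (Phi (ln a)).
  have sE : sqr_point A b sigma (ln (- a)) = sqr_point A b sigma (ln a).
    rewrite /sqr_point; congr point_of; apply/rowP => i; rewrite !mxE eqxx /=.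
    by case: eqVneq => [->|_]; rewrite ?yt ?mulr0 // !add0r !mulr1 sqrrN.
  apply/rowP => k; rewrite [RHS]mxE [flip _ _ _]mxE.
  have [/(vertex_orderP vs)[i ->]|kv] := boolP (k \in active A b v).
    rewrite !(chart_param_active vs) !mxE eqxx /=; have [_ si _] := vs.
    rewrite (inj_eq si); case: eqVneq => [->|_]; last by rewrite !mulr0 mul1r.
    by rewrite yt !add0r !mulr1 mulN1r.
  rewrite !(chart_param_inactive vs) // sE; case: eqVneq => [E|_]; last by rewrite mul1r.
  by move: kv; rewrite E (vertex_order_active vs).
have pe : \forall a \near (0 : R), p (- a) = p a.
  apply: filterS lnU => a Ua; rewrite /p lnN.
  have Xa := chart_param_real vs Ua.
  rewrite (sign_extension_signs fh (flip_signs (sigma t)) Xa) [LHS]mxE.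
  have [_ si _] := vs.
  by rewrite [flip _ _ _]mxE (inj_eq si) eq_sym (negbTE ts) mul1r.
have dp := even_diff0 pD pe.
have [pd pE] := pD.
have /derivable1_diffP pder := pd.
have D1 : 'D_1 p 0 = 0 by rewrite deriveE // pE.
have lim0 : a^-1 *: (p (a *: 1 + 0) - p 0) @[a --> (0 : R)^'] --> (0 : R).
  have H : a^-1 *: (p (a *: 1 + 0) - p 0) @[a --> (0 : R)^'] --> 'D_1 p 0 := pder.
  by rewrite D1 in H.
have gE a : 0 <= a -> chart_domain A b v sigma (ln a) -> gtilde (ln a) = p a.
  move=> a0 Ua; have lo : orthant (ln a).
    by move=> i; rewrite !mxE addr_ge0 // mulr_ge0.
  have [Sy _ _] := chart_param_dom vs Ua lo.
  by rewrite /gtilde (chart_invE vs Ua lo) /p (sign_extension_s_image Sy).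
have g0 : gtilde y = p 0.
  have U0 : chart_domain A b v sigma (ln 0) by rewrite ln0.
  by have := gE 0 (lexx 0) U0; rewrite ln0.
have nE : \forall a \near (0 : R)^'+, a^-1 * (gtilde (ln a) - gtilde y) =
    a^-1 *: (p (a *: 1 + 0) - p 0).
  rewrite near_withinE; apply: filterS lnU => a Ua a0.
  have ga := gE a (ltW a0) Ua; rewrite ga g0.
  have E1 : a *: (1 : R) + 0 = a by rewrite addr0; exact: mulr1.
  by rewrite E1.
have lim1 : a^-1 *: (p (a *: 1 + 0) - p 0) @[a --> (0 : R)^'+] --> (0 : R).
  move=> V HV; have := lim0 V HV; rewrite /= !nbhs_simpl /=.
  change ((\forall a \near (0 : R), a != 0 -> V (a^-1 *: (p (a *: 1 + 0) - p 0))) ->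
    (\forall a \near (0 : R), 0 < a -> V (a^-1 *: (p (a *: 1 + 0) - p 0)))).
  by apply: filterS => a Ha a0; apply: Ha; rewrite gt_eqF.
apply: cvg_trans lim1; apply: near_eq_cvg.
by apply: filterS nE => a ->.
Qed.

End Diffeo.

Section Facets.
Context {R : realType}.
Variables (m n : nat).

Lemma s_map_facet (A : 'M[R]_(m, n)) (b : 'rV[R]_m) i :
  s_map A b @` facet A b i = [set r | s_image A b r /\ r 0 i = 0].
Proof.
apply/seteqP; split=> [_ [x [Px xi] <-]|r [[x Px <-]]].
  by split; [exists x | rewrite mxE xi sqrtr0].
rewrite mxE => /eqP; rewrite sqrtr_eq0 => xi; exists x => //; split=> //.
by apply/eqP; rewrite eq_le xi Px.
Qed.

Lemma modulus_map_cancel (A A' : 'M[R]_(m, n)) (b b' : 'rV[R]_m) f h r :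
  torus_iso (moment_angle A b) (moment_angle A' b') f h ->
  s_image A b r -> modulus_map h (modulus_map f r) = r.
Proof.
move=> fh Sr; have hf := torus_iso_sym fh.
rewrite -(sign_extension_s_image hf (modulus_map_s_image fh Sr)).
rewrite -(sign_extension_s_image fh Sr).
by apply: (sign_extension_cancel fh); exact: s_image_real.
Qed.

End Facets.

Theorem theorem4p1 (R : realType) (m n : nat)
    (A A' : 'M[R]_(m, n)) (b b' : 'rV[R]_m)
    (HP : simple_polytope A b) (HQ : simple_polytope A' b')
    (f : 'rV[R[i]]_m -> 'rV[R[i]]_m)
    (f_diffeo : complex_Cr_diffeo None (moment_angle A b) (moment_angle A' b') f)
    (f_equiv : torus_equivariant (moment_angle A b) f) :
  exists g psi : 'rV[R]_m -> 'rV[R]_m,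
    (* (1) *)
    [/\ (forall (r phi : 'rV[R]_m), s_image A b r ->
           f (\row_k (real_complex R (r 0 k) * expi (phi 0 k))) =
           \row_k (expi (phi 0 k) * real_complex R (g r 0 k) * expi (psi r 0 k))),
        (forall r k, s_image A b r -> r 0 k = 0 -> g r 0 k = 0),
        (forall r k, s_image A b r -> 0 <= g r 0 k),
        (forall k, {within s_image A b, continuous (fun r => g r 0 k)}) &
        (forall k, {within s_image A b, continuous (fun r => psi r 0 k)})] /\
    (* (2) *)
    [/\ corner_manifold_diffeo (Some 1%N)
          (s_image A b) (quadratic_atlas A b)
          (s_image A' b') (quadratic_atlas A' b') g,
        (forall F, is_facet (polytope A b) F ->
           exists2 G, is_facet (polytope A' b') G &
             g @` (s_map A b @` F) = s_map A' b' @` G) &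
        (forall v sigma, vertex_order A b v sigma ->
           let c := vertex_chart A b v sigma in
           let gtilde s y := g (chart_inv c y) 0 (sigma s) in
           forall (s t : 'I_n) (y : 'rV[R]_n), t != s ->
             (chart_coord c @` chart_dom c) y -> y 0 t = 0 ->
             h^-1 * (gtilde s (y + h *: delta_mx 0 t) - gtilde s y)
               @[h --> 0^'+] --> (0 : R))] /\
    (* (3) *)
    Cr_diffeo (Some 1%N) (real_moment_angle A b) (real_moment_angle A' b')
      (sign_extension g) /\
    sign_equivariant (real_moment_angle A b) (sign_extension g).
Proof.
have [h fh] := torus_iso_of_diffeo f_diffeo f_equiv.
have hf := torus_iso_sym fh.
have /choice[th Hth] := continuous_phase HP fh.
exists (modulus_map f), (fun r => \row_k th k r); split; [|split; [|split]].
- split.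
  + move=> r phi Sr; have Xr := s_image_real Sr.
    pose t : 'rV[R[i]]_m := \row_k expi (phi 0 k).
    have t1 k : `|t 0 k| = 1.
      by rewrite mxE normc_def /= cos2Dsin2 sqrtr1.
    have -> : \row_k (real_complex R (r 0 k) * expi (phi 0 k)) =
        coord_mul t (map_mx (real_complex R) r).
      by apply/rowP => k; rewrite !mxE mulrC.
    rewrite (iso_equiv fh) //; apply/rowP => k; rewrite [LHS]mxE [RHS]mxE.
    have [-> _] := Hth k r Sr; rewrite [t 0 k]mxE [(\row_k0 th k0 r) 0 k]mxE.
    by rewrite -mulrA [expi (th k r) * _]mulrC.
  + by move=> r k Sr rk; apply/eqP; rewrite (modulus_map_eq0 fh) // rk.
  + by move=> r k Sr; have /s_imageP[_] := modulus_map_s_image fh Sr; apply.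
  + move=> k; apply/subspace_continuousP => r Sr.
    exact: (modulus_map_continuous HP fh (k := k) Sr).
  + move=> k; apply/subspace_continuousP => r Sr.
    have -> : (fun r => (\row_k0 th k0 r : 'rV[R]_m) 0 k) = th k.
      by apply/funext => x; rewrite mxE.
    by have [_] := Hth k r Sr.
- split.
  + exists (modulus_map h); split.
    * move=> r Sr; split; first exact: (modulus_map_s_image fh).
      exact: (modulus_map_cancel fh).
    * move=> r Sr; split; first exact: (modulus_map_s_image hf).
      exact: (modulus_map_cancel hf).
    * move=> _ _ [v [sigma [vs ->]]] [v' [sigma' [vs' ->]]].
      exact: (modulus_map_corner_Cr HP fh vs vs').
    * move=> _ _ [v [sigma [vs ->]]] [v' [sigma' [vs' ->]]].
      exact: (modulus_map_corner_Cr HQ hf vs vs').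
  + move=> F /(facets_exactly HP)[i ->]; exists (facet A' b' i).
      by apply/(facets_exactly HQ); exists i.
    rewrite !s_map_facet; apply/seteqP; split=> [_ [r [Sr ri] <-]|r [Sr ri]].
      split; first exact: (modulus_map_s_image fh).
      by apply/eqP; rewrite (modulus_map_eq0 fh) // ri.
    exists (modulus_map h r); last exact: (modulus_map_cancel hf).
    split; first exact: (modulus_map_s_image hf).
    by apply/eqP; rewrite (modulus_map_eq0 hf) // ri.
  + move=> v sigma vs c gtilde s t y ts cy yt.
    exact: (modulus_map_normal_derivative HP fh vs ts cy yt).
- exists (sign_extension (modulus_map h)); split.
  + move=> u Xu; split; first exact: (sign_extension_stable fh).
    exact: (sign_extension_cancel fh).
  + move=> u Xu; split; first exact: (sign_extension_stable hf).
    exact: (sign_extension_cancel hf).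
  + exact: (sign_extension_Cr HP fh).
  + exact: (sign_extension_Cr HQ hf).
- by move=> e u He Xu; exact: (sign_extension_signs fh).
Qed.
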